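(* Let $f \in \mathbb{Z}[X_1, X_2, Y_1, Y_2]$ be a bihomogeneous polynomial of bidegree $(d_1, d_2)$ with $d_1, d_2 \ge 1$, irreducible over $\mathbb{Q}$. Then for all $B_1 \ge 1$ and $B_2 \ge 2$, \[ N_{\mathbb{P}^1 \times \mathbb{P}^1}(f, B_1, B_2) \ll d_1^7 d_2^4 B_1^{2/d_2} (\log B_2)^2, \] with an absolute implied constant.
   Context: A polynomial in $\mathbb{Z}[X_1,X_2,Y_1,Y_2]$ is bihomogeneous of bidegree $(d_1,d_2)$ if it is homogeneous of degree $d_1$ in $(X_1,X_2)$ and homogeneous of degree $d_2$ in $(Y_1,Y_2)$. For a point $(x_1:x_2)\in\mathbb{P}^1(\mathbb{Q})$ with coprime integer coordinates, $H(x_1:x_2)=\max(|x_1|,|x_2|)$. $N_{\mathbb{P}^1\times\mathbb{P}^1}(f,B_1,B_2)$ is the number of $((x_1:x_2),(y_1:y_2))\in\mathbb{P}^1(\mathbb{Q})\times\mathbb{P}^1(\mathbb{Q})$ with $f(x_1,x_2,y_1,y_2)=0$, $H(x_1:x_2)\le B_1$ and $H(y_1:y_2)\le B_2$. *)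

(* Defs.v *)
From mathcomp Require Import all_boot all_algebra.
From mathcomp Require Import mpoly.
From Stdlib Require Import Reals.

Set Implicit Arguments.
Unset Strict Implicit.
Unset Printing Implicit Defensive.

Import GRing.Theory Num.Theory.
Local Open Scope ring_scope.

Definition vX1 : 'I_4 := @Ordinal 4 0 isT.
Definition vX2 : 'I_4 := @Ordinal 4 1 isT.
Definition vY1 : 'I_4 := @Ordinal 4 2 isT.
Definition vY2 : 'I_4 := @Ordinal 4 3 isT.

Definition bihomogeneous (d1 d2 : nat) (f : {mpoly int[4]}) : Prop :=
  forall m : 'X_{1..4}, m \in msupp f ->
    (m vX1 + m vX2 = d1)%N /\ (m vY1 + m vY2 = d2)%N.

Definition mpoly_irreducible (R : idomainType) (p : {mpoly R[4]}) : Prop :=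
  p != 0 /\ p \isn't a GRing.unit /\
  forall q r : {mpoly R[4]}, p = q * r ->
    q \is a GRing.unit \/ r \is a GRing.unit.

Definition irreducible_over_Q (f : {mpoly int[4]}) : Prop :=
  mpoly_irreducible (map_mpoly (intr : int -> rat) f).

Definition eval4 (f : {mpoly int[4]}) (x1 x2 y1 y2 : int) : int :=
  f.@[fun i : 'I_4 => nth 0 [:: x1; x2; y1; y2] i].

(* Canonical representative of a point of P^1(Q): coprime integer
   coordinates (x1,x2), normalized up to sign by x1 > 0, or x1 = 0, x2 = 1.
   Every point of P^1(Q) has exactly one such representative. *)
Definition P1_rep (x1 x2 : int) : bool :=
  coprimez x1 x2 && ((0 < x1) || ((x1 == 0) && (x2 == 1))).

Definition height (x1 x2 : int) : nat := maxn (absz x1) (absz x2).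

Definition zrange (n : nat) : seq int :=
  [seq (i%:Z - n%:Z) | i <- iota 0 (2 * n).+1].

Definition Rleb (a b : R) : bool := if Rle_dec a b then true else false.

(* N_{P^1 x P^1}(f, B1, B2): number of ((x1:x2),(y1:y2)) in P^1(Q) x P^1(Q)
   with f = 0, H(x) <= B1, H(y) <= B2.  Points are counted through their
   canonical representatives; the box [-n,n] with n = Z.to_nat (up B) contains
   all integers of absolute value <= B, the exact bound being the filter. *)
Definition N_P1P1 (f : {mpoly int[4]}) (B1 B2 : R) : nat :=
  let r1 := zrange (Z.to_nat (up B1)) in
  let r2 := zrange (Z.to_nat (up B2)) in
  count (fun p : (int * int) * (int * int) =>
           let '((x1, x2), (y1, y2)) := p in
           [&& P1_rep x1 x2, P1_rep y1 y2,
               Rleb (INR (height x1 x2)) B1,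
               Rleb (INR (height y1 y2)) B2 &
               eval4 f x1 x2 y1 y2 == 0])
        [seq (x, y) | x <- [seq (x1, x2) | x1 <- r1, x2 <- r1],
                      y <- [seq (y1, y2) | y1 <- r2, y2 <- r2]].

(* Main.v *)
Require Import Defs.
From mathcomp Require Import all_boot all_order all_fingroup all_algebra.
From mathcomp Require Import mpoly.
From mathcomp Require Import algC.
From mathcomp Require Import ring zify.

(* The p-adic determinant method on P^1 x P^1.  Let S be the set of points to
   be counted.  A kernel vector made of minors gives a nonzero integral form g
   of bidegree (d1, d2) with small coefficients vanishing on S.  If g is not
   proportional to f, then Bezout bounds |S|; otherwise f may be replaced by g.
   The points with g_Y1 = 0 are again few by Bezout.  At any other point g_Y1
   is a nonzero integer of controlled size, so by averaging over the primes of
   (Q, 6 Q] (whose product is at least 2 ^ Q, by Chebyshev) there is a prime p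
   not dividing g_Y1 at half of these points.  Such points fall into at most
   2 p d2 classes modulo p; inside one class the curve is, p-adically, the
   graph of a polynomial (Hensel), so a determinant of s monomials of bidegree
   (D, d2 - 1) in s points, s = (D + 1) d2, is divisible by p ^ (s (s - 1) / 2).
   When p >> B1 ^ (2 / d2) and D >> log B2 this exceeds the size of the
   determinant, which is thus zero: the class lies on another curve of bidegree
   (D, d2 - 1), and Bezout bounds it by d1 (d2 - 1) + d2 D + 1.  Taking
   Q ~ d1 ^ 2 d2 ^ 2 B1 ^ (2 / d2) log B2 gives the theorem. *)

Set Implicit Arguments.
Unset Strict Implicit.
Unset Printing Implicit Defensive.

(** * Primes in (Q, 6 Q] *)

(** The implied constant may not depend on the coefficients of f, yet p has to avoid most values of
    a derivative. This is why f is traded for g: the coefficients of g are bounded in terms of d1,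
    d2, B1, B2 alone, while a g proportional to f keeps its zeros and its irreducibility. With M =
    (d1 + 1) (d2 + 1), the logarithm of a value of g_Y1 is at most of order M log (M B1 ^ d1 B2 ^
    d2). Since log B1 <= (d2 / 2) B1 ^ (2 / d2), this is O(d1 ^ 2 d2 ^ 2 B1 ^ (2 / d2) log B2),
    whence the size of Q. The determinant of a class is about B1 ^ (D s) B2 ^ ((d2 - 1) s), to be
    compared with p ^ (s (s - 1) / 2), where s - 1 >= D d2. Balancing the powers of B1 gives the
    exponent 2 / d2; once B2 <= 2 ^ D, the powers of B2 only cost a constant factor in p. Of the two
    factors log B2 in the theorem, one comes from Q and the other from D. *)

Lemma central_binS n :
  n.+1 * 'C(2 * n.+1, n.+1) = 2 * (2 * n).+1 * 'C(2 * n, n).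
Proof.
have := mul_bin_diag (2 * n.+1) n; have := mul_bin_down (2 * n).+1 n.
rewrite mulnS add2n /= (_ : (2 * n).+1 - n = n.+1); last lia.
move=> E1 E2; rewrite -E2 -mulnA E1; lia.
Qed.

Lemma central_bin_ge n : 0 < n -> 4 ^ n <= 2 * n * 'C(2 * n, n).
Proof.
elim: n => // -[|n] IH _; first by [].
have := central_binS n.+1; have := IH isT; rewrite (expnS 4 n.+1); nia.
Qed.

Lemma central_bin_le n : 'C(2 * n, n) <= 4 ^ n.
Proof.
have -> : 4 ^ n = (1 + 1) ^ (2 * n) by rewrite -(expnM 2 2 n).
rewrite expnDn; have h : n < (2 * n).+1 by lia.
by rewrite (bigD1 (Ordinal h)) //= !exp1n !muln1 leq_addr.
Qed.

(** By Legendre's formula the valuation is the sum over k of [(2 * n) %/ p ^ k - 2 * (n %/ p ^ k)].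
    Each term is 0 or 1, and it is 0 as soon as [p ^ k] exceeds [2 * n]. *)
Lemma logn_central_bin p n : prime p -> 0 < n ->
  logn p 'C(2 * n, n) <= trunc_log p (2 * n).
Proof.
move=> pp n0.
have E : 'C(2 * n, n) * (n`! * n`!) = (2 * n)`!.
  by rewrite -{4}(_ : 2 * n - n = n) ?bin_fact //; lia.
have := congr1 (logn p) E.
have lt : 0 < 'C(2 * n, n) by rewrite bin_gt0; lia.
rewrite !lognM ?muln_gt0 ?fact_gt0 // !logn_fact //.
(* The extra terms vanish because [p ^ k > k > n]; both Legendre sums now have the same range. *)
have -> : \sum_(1 <= k < n.+1) n %/ p ^ k = \sum_(1 <= k < (2 * n).+1) n %/ p ^ k.
  rewrite [RHS](@big_cat_nat _ _ addn n.+1) //=; last by lia.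
  rewrite [X in _ + X]big_nat_cond [X in _ + X]big1 ?addn0 // => k.
  rewrite andbT => /andP [nk _]; rewrite divn_small //.
  by apply: ltn_trans (ltn_expl _ (prime_gt1 pp)).
rewrite addnn -mul2n big_distrr /= => Ev.
set t := trunc_log _ _.
have : \sum_(1 <= k < (2 * n).+1) (2 * n) %/ p ^ k <=
  \sum_(1 <= k < (2 * n).+1) 2 * (n %/ p ^ k) +
  \sum_(1 <= k < (2 * n).+1) (k <= t).
  rewrite -big_split /=; apply: leq_sum => k _.
  have pk : 0 < p ^ k by rewrite expn_gt0 prime_gt0.
  case: (leqP k t) => kt.
    suff : (2 * n) %/ p ^ k < 2 * (n %/ p ^ k) + 2 by rewrite /=; lia.
    by rewrite ltn_divLR //; have := ltn_ceil n pk; nia.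
  rewrite divn_small //.
  by apply: leq_trans (trunc_log_ltn _ (prime_gt1 pp)) _; rewrite leq_exp2l ?prime_gt1.
have : \sum_(1 <= k < (2 * n).+1) (k <= t) <= t.
  move: ((2 * n).+1) => m; elim: m => [|m IH]; first by rewrite big_nil.
  have [->|m0] := posnP m; first by rewrite big_nil.
  rewrite big_nat_recr //=.
  have [lmt|] := leqP m t; last by rewrite addn0.
  suff : \sum_(1 <= i < m) (i <= t) <= m.-1 by lia.
  apply: leq_trans (_ : \sum_(1 <= i < m) 1 <= _).
    by apply: leq_sum => i _; apply: leq_b1.
  by rewrite sum_nat_const_nat muln1 subn1.
rewrite -/t; lia.
Qed.

Definition primorial a b := \prod_(a.+1 <= p < b.+1 | prime p) p.

Lemma primorial_gt0 a b : 0 < primorial a b.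
Proof. by apply: prodn_cond_gt0 => p; apply: prime_gt0. Qed.

Lemma primorial_cat a b c : a <= b -> b <= c ->
  primorial a c = primorial a b * primorial b c.
Proof. by move=> ab bc; rewrite /primorial -big_cat_nat. Qed.

Lemma prod_primes_dvd m a b (P : pred nat) :
  (forall p, P p -> prime p && (p %| m)) -> \prod_(a <= p < b | P p) p %| m.
Proof.
move=> hP; elim: b => [|b IH]; first by rewrite big_geq ?dvd1n.
have [ab|ab] := ltnP b a; first by rewrite big_geq ?dvd1n.
rewrite big_mkcond big_nat_recr //= -big_mkcond /=.
case: ifP => [Pb|_]; last by rewrite muln1.
have /andP [pb bm] := hP _ Pb.
rewrite Gauss_dvd ?IH ?bm //.
rewrite big_nat_cond; apply: (big_ind (fun x => coprime x b)); first exact: coprime1n.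
  by move=> x y cx cy; rewrite coprimeMl cx.
move=> p /andP [/andP [_ pb'] /hP /andP [pp _]].
rewrite prime_coprime // dvdn_prime2 //; lia.
Qed.

Lemma primorial_dvd m a b :
  (forall p, prime p -> a < p -> p <= b -> p %| m) -> primorial a b %| m.
Proof.
move=> h; rewrite /primorial big_nat_cond; apply: prod_primes_dvd => p.
by case/andP => /andP [ap pb] pp; rewrite pp h.
Qed.

(** Erdos' argument by doubling: a prime in (2 ^ k, 2 ^ k.+1] divides [(2 * 2 ^ k)]![but not](2 ^
    k)[!], hence it divides the central binomial coefficient, which is at most [4 ^ (2 ^ k)]. *)
Lemma primorial_pow2 k : primorial 0 (2 ^ k) <= 4 ^ (2 ^ k).
Proof.
elim: k => [|k IH]; first by rewrite /primorial big_mkcond big_nat1.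
rewrite (@primorial_cat _ (2 ^ k)) ?leq_exp2l //.
have -> : 4 ^ (2 ^ k.+1) = 4 ^ (2 ^ k) * 4 ^ (2 ^ k).
  by rewrite -expnD addnn -mul2n -expnS.
apply: leq_mul => //; apply: leq_trans (central_bin_le (2 ^ k)).
apply: dvdn_leq; first by rewrite bin_gt0; lia.
apply: primorial_dvd => p pp ap; rewrite expnS => pb.
have E : 'C(2 * 2 ^ k, 2 ^ k) * ((2 ^ k)`! * (2 ^ k)`!) = (2 * 2 ^ k)`!.
  have := @bin_fact (2 * 2 ^ k) (2 ^ k).
  by rewrite (_ : 2 * 2 ^ k - 2 ^ k = 2 ^ k) => [->//|]; lia.
have : p %| (2 * 2 ^ k)`! by rewrite dvdn_fact // prime_gt0.
have np : ~~ (p %| (2 ^ k)`!).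
  apply/negP => d; have : 0 < logn p (2 ^ k)`! by rewrite logn_gt0 mem_primes pp fact_gt0.
  rewrite logn_fact // big_nat_cond big1 // => i /andP [/andP [i0 _] _].
  by rewrite divn_small // (leq_trans ap) // -{1}(expn1 p) leq_exp2l ?prime_gt1.
by rewrite -E !Euclid_dvdM // (negbTE np) !orbF.
Qed.

Lemma central_bin_prod n : 0 < n ->
  'C(2 * n, n) = \prod_(1 <= p < (2 * n).+1 | prime p) p ^ logn p 'C(2 * n, n).
Proof.
move=> n0; set C := 'C(_, _).
have C0 : 0 < C by rewrite bin_gt0; lia.
rewrite (bigID (dvdn^~ C)) /= [X in _ * X]big1 ?muln1; last first.
  by move=> p /andP [pp nd]; rewrite (eqP (_ : logn p C == 0)) //
     -leqn0 leqNgt logn_gt0 mem_primes pp C0.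
rewrite -big_filter {1}[C]prod_prime_decomp // prime_decompE big_map /=.
apply: perm_big; apply: uniq_perm; first exact: primes_uniq.
  by rewrite filter_uniq // iota_uniq.
move=> p; rewrite mem_primes mem_filter mem_index_iota C0 /=.
case: (boolP (prime p)) => //= pp; case: (boolP (p %| C)) => //= pC.
have l0 : 0 < logn p C by rewrite logn_gt0 mem_primes pp C0.
have n20 : 0 < 2 * n by lia.
have := trunc_logP (prime_gt1 pp) n20.
have := logn_central_bin pp n0; rewrite -/C => l1 l2.
rewrite prime_gt0 // ltnS; apply/esym; apply: leq_trans l2.
by rewrite -{1}(expn1 p) leq_exp2l ?prime_gt1 // (leq_trans l0).
Qed.

Lemma big_nat_le_const (P : pred nat) (F : nat -> nat) a b c :
  0 < c -> (forall p, P p -> a <= p < b -> F p <= c) ->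
  \prod_(a <= p < b | P p) F p <= c ^ (b - a).
Proof.
move=> c0 h; rewrite -[c ^ _](@prod_nat_const_nat a b c) big_mkcond /=.
rewrite big_nat_cond [X in _ <= X]big_nat_cond; apply: leq_prod => p.
by rewrite andbT => pab; case: ifP => // Pp; apply: h.
Qed.

(** A prime power in the factorization of the binomial coefficient is at most [2 * n], which handles
    the primes up to [r]. Beyond [r] the square of a prime exceeds [2 * n], so the exponent is at
    most 1. *)
Lemma primorial_central_bin n r Q : 0 < n -> r <= Q -> Q <= 2 * n -> 2 * n < r.+1 ^ 2 ->
  'C(2 * n, n) <= (2 * n) ^ r * primorial 0 Q * primorial Q (2 * n).
Proof.
move=> n0 rQ Qn hr; rewrite {1}central_bin_prod //.
rewrite (@big_cat_nat _ _ muln r.+1) //=; last by lia.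
rewrite -mulnA -primorial_cat //; apply: leq_mul.
  apply: leq_trans (_ : (2 * n) ^ (r.+1 - 1) <= _); last by rewrite subn1.
  apply: big_nat_le_const; first by lia.
  move=> p pp _; apply: leq_trans (_ : p ^ trunc_log p (2 * n) <= _).
    by rewrite leq_exp2l ?prime_gt1 ?logn_central_bin.
  by apply: trunc_logP; [exact: prime_gt1 | lia].
apply: leq_trans (_ : primorial r (2 * n) <= _); last first.
  rewrite (@primorial_cat 0 r); try lia.
  by rewrite leq_pmull // primorial_gt0.
rewrite /primorial big_nat_cond [X in _ <= X]big_nat_cond; apply: leq_prod => p.
move=> /andP [/andP [rp pn] pp]; rewrite -{3}(expn1 p) leq_exp2l ?prime_gt1 //.
apply: leq_trans (logn_central_bin pp n0) _.
rewrite -ltnS -(@ltn_exp2l p) ?prime_gt1 //; apply: leq_ltn_trans (trunc_logP (prime_gt1 pp) _) _.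
  by lia.
by apply: leq_trans hr _; rewrite leq_exp2r.
Qed.

(* With [Q = 4 ^ k] the exponents below are exact powers of two, and
   [r = 3 * 2 ^ k >= sqrt (6 * Q)]. *)
Lemma primorial_ge k : 4 <= k -> 2 ^ (4 ^ k) <= primorial (4 ^ k) (6 * 4 ^ k).
Proof.
move=> k4; set Q := 4 ^ k.
have EQ : Q = 2 ^ k * 2 ^ k by rewrite /Q -expnD addnn -mul2n expnM.
have pk : 16 <= 2 ^ k by rewrite (@leq_exp2l 2 4).
have E6 : 2 * (3 * Q) = 6 * Q by lia.
have := @primorial_central_bin (3 * Q) (3 * 2 ^ k) Q; rewrite E6.
move=> /(_ ltac:(nia) ltac:(nia) ltac:(nia) ltac:(rewrite -mulnn; nia)) h1.
have h2 := @central_bin_ge (3 * Q) ltac:(nia); rewrite E6 in h2.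
have h3 : primorial 0 Q <= 4 ^ Q.
  by rewrite EQ -expnD addnn -mul2n; apply: primorial_pow2.
have h4 : 6 * Q <= 2 ^ (2 * k + 3).
  by rewrite expnD (expnM 2 2 k) mulnC leq_mul2l orbT.
(* This inequality between exponents of 2 fails at k = 3 (225 against 192), which explains the
   hypothesis [4 <= k]. *)
have h5 : (2 * k + 3) * (3 * 2 ^ k + 1) <= 3 * Q.
  rewrite EQ; elim: k k4 {Q EQ E6 pk h1 h2 h3 h4} => // k IH.
  rewrite leq_eqVlt => /predU1P [<- //|k4]; have := IH k4; rewrite !expnS.
  have : 16 <= 2 ^ k by rewrite (@leq_exp2l 2 4).
  by nia.
have h6 : (6 * Q) ^ (3 * 2 ^ k + 1) <= 8 ^ Q.
  apply: leq_trans (_ : (2 ^ (2 * k + 3)) ^ (3 * 2 ^ k + 1) <= _).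
    by rewrite leq_exp2r // addn1.
  by rewrite -expnM -[8]/(2 ^ 3) -expnM leq_exp2l.
set P := primorial Q (6 * Q) in h1 *.
(* The left side is [64 ^ Q], and 64 = 8 * 4 * 2 leaves [2 ^ Q] for [P]. *)
have h7 : 4 ^ (3 * Q) <= 8 ^ Q * 4 ^ Q * P.
  apply: leq_trans h2 _; apply: leq_trans (leq_mul (leqnn _) h1) _.
  rewrite !mulnA; apply: leq_mul => //.
  by apply: leq_mul => //; move: h6; rewrite addn1 expnS.
rewrite -(@leq_pmul2l (8 ^ Q * 4 ^ Q)) ?muln_gt0 ?expn_gt0 //.
by apply: leq_trans h7; rewrite -!expnMn expnM.
Qed.

Import Order.TTheory GRing.Theory Num.Theory.
Local Open Scope ring_scope.

(** * Small solutions of linear systems *)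

(** The signed minors on the right do not involve the bordering row [i]. If all the bordered minors
    vanish, they therefore form one vector orthogonal to every row of [A]. *)
Lemma mxsub_swap0 (R : comPzRingType) m n r (A : 'M[R]_(m, n))
  (g : 'I_r -> 'I_m) (h : 'I_r.+1 -> 'I_n) (i : 'I_m) :
  \det (mxsub (fun k => if unlift ord0 k is Some k' then g k' else i) h A)
  = \sum_(l < r.+1) A i (h l) *
      ((-1) ^+ l * \det (mxsub g (h \o lift l) A)).
Proof.
rewrite (expand_det_row _ ord0); apply: eq_bigr => l _.
rewrite mxE unlift_none; congr (_ * _).
rewrite /cofactor add0n; congr (_ * \det _).
by apply/matrixP => a b; rewrite !mxE liftK.
Qed.

(** Selecting columns is multiplication by a 0-1 matrix, so a minor with as many columns as [A]
    vanishes together with the corresponding [rowsub]. *)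
Lemma det_mxsub_sq (R : comPzRingType) m n (A : 'M[R]_(m, n)) (g : 'I_n -> 'I_m)
  (h : 'I_n -> 'I_n) :
  \det (mxsub g h A) = \det (rowsub g A) * \det (\matrix_(i, j) (i == h j)%:R).
Proof.
rewrite -det_mulmx; congr (\det _); apply/matrixP => i j; rewrite !mxE.
rewrite (bigD1 (h j)) //= !mxE eqxx mulr1 big1 ?addr0 // => k /negbTE nk.
by rewrite !mxE nk mulr0.
Qed.

Lemma norm_det_le n (A : 'M[int]_n) (B : int) :
  (forall i j, `|A i j| <= B) -> `|\det A| <= n`!%:R * B ^+ n.
Proof.
move=> HA; rewrite /determinant; apply: le_trans (ler_norm_sum _ _ _) _.
rewrite -card_Sn mulr_natl -sumr_const; apply: ler_sum => s _.
rewrite normrM normrX normrN1 expr1n mul1r normr_prod.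
apply: le_trans (_ : \prod_(i < n) B <= _); last by rewrite prodr_const card_ord.
by apply: ler_prod => i _; rewrite HA normr_ge0.
Qed.

Lemma fact_leq_exp n m : (n <= m -> n`! <= m ^ n)%N.
Proof.
elim: n => [|n IH] // lnm; rewrite factS expnS leq_mul // IH //; exact: ltnW.
Qed.

(* The kernel vector is made of the cofactors of a maximal nonvanishing minor
   bordered by one more column. *)
Lemma small_kernel m n (A : 'M[int]_(m, n)) (B : int) :
  1 <= B -> (forall i j, `|A i j| <= B) ->
  (forall g : 'I_n -> 'I_m, \det (rowsub g A) = 0) ->
  exists c : 'I_n -> int,
    [/\ exists j, c j != 0,
        forall i, \sum_j A i j * c j = 0
      & forall j, `|c j| <= (n%:R * B) ^+ n].
Proof.
move=> B1 HA H0.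
have B0 : 0 <= B by apply: le_trans B1.
pose P r := [exists g : {ffun 'I_r -> 'I_m}, exists h : {ffun 'I_r -> 'I_n},
               \det (mxsub g h A) != 0].
have P0 : exists r, P r.
  exists 0%N; apply/existsP; exists [ffun x : 'I_0 => match notF (ltn_ord x) with end].
  apply/existsP; exists [ffun x : 'I_0 => match notF (ltn_ord x) with end].
  by rewrite det_mx00.
have Pn r : P r -> (r < n)%N.
  case/existsP => g /existsP [h nz].
  have injh : injective h.
    move=> a b hab; apply/eqP/negPn/negP => nab.
    case/eqP: nz; rewrite -det_tr (determinant_alternate nab) //.
    by move=> k; rewrite !mxE hab.
  have lern : (r <= n)%N by have := leq_card h injh; rewrite !card_ord.
  rewrite ltn_neqAle lern andbT; apply/eqP => ern; subst r.
  by move: nz; rewrite det_mxsub_sq H0 mul0r eqxx.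
have Pn' r : P r -> (r <= n)%N by move/Pn/ltnW.
case: (ex_maxnP P0 Pn') => r Pr rmax.
have rn := Pn _ Pr.
case/existsP: Pr => g /existsP [h nz].
have [j0 j0h] : exists j0, j0 \notin codom h.
  apply/existsP; rewrite -negb_forall; apply/negP => /forallP hall.
  have : (n <= r)%N.
    rewrite -{1}(card_ord n) -{1}(card_ord r) -(size_codom h).
    rewrite cardE; apply: uniq_leq_size (enum_uniq _) _ => x _; exact: hall.
  by rewrite leqNgt rn.
pose h' (k : 'I_r.+1) := if unlift ord0 k is Some k' then h k' else j0.
pose cof (l : 'I_r.+1) := (-1) ^+ l * \det (mxsub g (h' \o lift l) A).
have key i : \sum_(l < r.+1) A i (h' l) * cof l = 0.
  rewrite -mxsub_swap0; apply/eqP/negPn/negP => nz'.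
  have : P r.+1.
    apply/existsP; exists [ffun k => if unlift ord0 k is Some k' then g k' else i].
    apply/existsP; exists [ffun k => h' k].
    suff -> : mxsub [ffun k => if unlift ord0 k is Some k' then g k' else i]
      [ffun k => h' k] A =
      mxsub (fun k => if unlift ord0 k is Some k' then g k' else i) h' A by [].
    by apply/matrixP => a b; rewrite !mxE !ffunE.
  by move/rmax; rewrite ltnn.
have fine l : `|cof l| <= r`!%:R * B ^+ r.
  rewrite normrM normrX normrN1 expr1n mul1r.
  by apply: norm_det_le => a b; rewrite mxE HA.
exists (fun j => \sum_(l < r.+1 | h' l == j) cof l); split.
(* The column [j0] is not in the image of [h], so its entry is a single cofactor: the chosen nonzero
   minor. *)
- exists j0; rewrite (bigD1 ord0) /=; last by rewrite /h' unlift_none.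
  rewrite big1 => [|l /andP [/eqP hl l0]].
    rewrite addr0 /cof expr0 mul1r.
    suff -> : mxsub g (h' \o lift ord0) A = mxsub g h A by [].
    by apply/matrixP => a b; rewrite !mxE /= /h' liftK.
  move: hl l0; rewrite /h'; case: unliftP => [l' -> hl _|-> _]; last by rewrite eqxx.
  by case/negP: j0h; rewrite -hl codom_f.
- move=> i; rewrite -[RHS](key i) [RHS](partition_big h' predT) //=.
  apply: eq_bigr => j _; rewrite mulr_sumr; apply: eq_bigr => l /eqP -> //.
- move=> j; apply: le_trans (ler_norm_sum _ _ _) _.
  apply: le_trans (_ : \sum_(l < r.+1) r`!%:R * B ^+ r <= _).
    rewrite big_mkcond /=; apply: ler_sum => l _; case: ifP => // _.
    by rewrite mulr_ge0 ?exprn_ge0.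
  rewrite sumr_const card_ord -[_ *+ _]mulr_natl mulrA -natrM -factS exprMn.
  apply: ler_pM => //; rewrite ?exprn_ge0 //.
    rewrite -natrX ler_nat; apply: leq_trans (fact_leq_exp rn) _.
    by rewrite leq_pexp2l //; case: (n) rn.
  by rewrite ler_weXn2l // ltnW.
Qed.

(** * Determinants and Hensel lifting over a nilpotent *)

(** Multilinearity in the rows: [f] records which summand is taken in each row. *)
Lemma det_sum_rows (R : comPzRingType) s N (u : 'I_s -> 'I_N -> R)
  (C : 'I_N -> 'I_s -> R) :
  \det (\matrix_(k, j) \sum_(m < N) u k m * C m j) =
  \sum_(f : {ffun 'I_s -> 'I_N})
     (\prod_k u k (f k)) * \det (\matrix_(k, j) C (f k) j).
Proof.
rewrite /determinant.
transitivity (\sum_(tau : 'S_s) \sum_(f : {ffun 'I_s -> 'I_N})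
   (-1) ^+ tau * \prod_k (u k (f k) * C (f k) (tau k))).
  apply: eq_bigr => tau _; rewrite -mulr_sumr.
  rewrite -(bigA_distr_bigA (fun k m => u k m * C m (tau k))) /=.
  by congr (_ * _); apply: eq_bigr => k _; rewrite mxE.
rewrite exchange_big; apply: eq_bigr => f _ /=; rewrite mulr_sumr.
apply: eq_bigr => tau _; rewrite big_split /= mulrCA.
by congr (_ * (_ * _)); apply: eq_bigr => k _; rewrite mxE.
Qed.

(** The minimum is 0 + 1 + ... + (s - 1). The induction removes the largest element, which is at
    least [n] because [n.+1] distinct naturals do not fit below [n]. *)
Lemma uniq_sumn_ge (l : seq nat) : uniq l -> ('C(size l, 2) <= sumn l)%N.
Proof.
move: {2}(size l) (erefl (size l)) => n; elim: n l => [|n IH] l sl ul.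
  by rewrite sl.
pose m := \max_(x <- l) x.
have ml : m \in l.
  rewrite /m; case: l sl {ul m} => // x l _.
  elim: l x => [|y l IH'] x; first by rewrite big_seq1 mem_head.
  rewrite big_cons; have := IH' y; set M := \max_(_ <- _) _ => hM.
  by case: (leqP x M) => _; rewrite in_cons ?hM ?eqxx ?orbT.
have nm : (n <= m)%N.
  rewrite -ltnS -sl -(size_iota 0 m.+1); apply: uniq_leq_size => // x xl.
  by rewrite mem_iota /= add0n ltnS (@leq_bigmax_seq _ l predT id x xl isT).
have pl := perm_to_rem ml.
have sr : size (rem m l) = n by rewrite size_rem // sl.
rewrite (perm_sumn pl) /= sl binS bin1 -sr addnC leq_add ?IH ?rem_uniq //.
by rewrite sr.
Qed.

Lemma inj_sum_ge s (f : 'I_s -> nat) :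
  injective f -> ('C(s, 2) <= \sum_k f k)%N.
Proof.
move=> fi; have := @uniq_sumn_ge (map f (enum 'I_s)).
by rewrite map_inj_uniq // enum_uniq size_map size_enum_ord sumnE big_map big_enum => ->.
Qed.

(** Expand each polynomial at [a] and use multilinearity: row k contributes some power [pi ^+ m].
    Two rows with the same m are proportional, so only choices with distinct exponents survive;
    their sum is at least ['C(s, 2)], and the power of [pi] is zero. *)
Lemma det_poly_nilp (R : comNzRingType) (pi : R) L s (a : R) (t : 'I_s -> R)
  (psi : 'I_s -> {poly R}) :
  pi ^+ L = 0 -> (L <= 'C(s, 2))%N ->
  \det (\matrix_(k, j) (psi j).[a + pi * t k]) = 0.
Proof.
move=> piL Ls.
pose q j := psi j \Po ('X + a%:P).
pose N := \max_j size (q j).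
have E : \matrix_(k, j) (psi j).[a + pi * t k] =
  \matrix_(k, j) \sum_(m < N) (pi ^+ m * t k ^+ m) * (q j)`_m.
  apply/matrixP => k j; rewrite !mxE.
  have -> : (psi j).[a + pi * t k] = (q j).[pi * t k].
    by rewrite horner_comp !hornerE addrC.
  have qN : (size (q j) <= N)%N by apply: (@leq_bigmax _ (fun i => size (q i))).
  rewrite (horner_coef_wide _ qN); apply: eq_bigr => m _.
  by rewrite mulrC exprMn.
rewrite E det_sum_rows big1 // => f _.
case: (boolP (injectiveb f)) => [/injectiveP fi | /injectivePn [x [y nxy fxy]]].
  rewrite big_split /= prodrXr.
  have le : (L <= \sum_k f k)%N.
    apply: leq_trans Ls _; apply: (@inj_sum_ge s (fun k => f k)).
    by move=> x y /val_inj /fi.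
  by rewrite -(subnKC le) exprD piL !mul0r.
rewrite (determinant_alternate nxy) ?mulr0 // => k.
by rewrite !mxE fxy.
Qed.

Definition fiber (R : nzRingType) (F : {poly {poly R}}) (x : R) : {poly R} :=
  map_poly (horner_eval x) F.

Lemma fiber_horner (R : comNzRingType) (F : {poly {poly R}}) (q : {poly R}) x :
  F.[q].[x] = (fiber F x).[q.[x]].
Proof. by have := horner_map (horner_eval x) F q; rewrite /= /horner_eval => ->. Qed.

Lemma fiber_deriv (R : comNzRingType) (F : {poly {poly R}}) x :
  fiber F^`() x = (fiber F x)^`().
Proof. by rewrite /fiber deriv_map. Qed.

Lemma taylor2 (R : comNzRingType) (p : {poly R}) x h :
  exists r, p.[x + h] = p.[x] + p^`().[x] * h + h ^+ 2 * r.
Proof.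
elim/poly_ind: p => [|p c [r IH]].
  by exists 0; rewrite deriv0 !horner0 mul0r mulr0 !addr0.
exists (p^`().[x] + r * (x + h)).
rewrite derivD derivM derivX derivC !hornerE IH; ring.
Qed.

Lemma taylor1 (R : comNzRingType) (p : {poly R}) x h :
  exists r, p.[x + h] = p.[x] + h * r.
Proof.
by case: (taylor2 p x h) => r ->; exists (p^`().[x] + h * r); ring.
Qed.

(** Newton's iteration is run on polynomials in X rather than at one point, with the inverse
    derivative frozen at its value [w] over [a]. Convergence is then only linear, one factor [pi]
    per step, but a single polynomial [phi] serves all x congruent to [a]. Uniqueness of the lift
    makes every nearby zero lie on its graph. *)
Lemma hensel_poly (R : comNzRingType) (pi : R) L (F : {poly {poly R}}) (a b w c : R) :
  pi ^+ L = 0 ->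
  w * (fiber F a)^`().[b] = 1 ->
  (fiber F a).[b] = pi * c ->
  exists phi : {poly R}, forall t u : R,
    (fiber F (a + pi * t)).[b + pi * u] = 0 -> b + pi * u = phi.[a + pi * t].
Proof.
move=> piL hw hc.
pose phi := fix phi n := if n is n'.+1 then phi n' - w *: F.[phi n'] else b%:P.
have dF t u : exists d, (fiber F (a + pi * t))^`().[b + pi * u] =
                        (fiber F a)^`().[b] + pi * d.
  have E y x : (fiber F x)^`().[y] = F^`().[y%:P].[x].
    by rewrite fiber_horner fiber_deriv hornerC.
  case: (taylor1 (fiber F (a + pi * t))^`() b (pi * u)) => r1 ->.
  rewrite (E b (a + pi * t)); case: (taylor1 F^`().[b%:P] a (pi * t)) => r2 ->.
  by rewrite (E b a); exists (t * r2 + u * r1); ring.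
have step n t : exists d e, (phi n).[a + pi * t] = b + pi * d /\
                  (fiber F (a + pi * t)).[(phi n).[a + pi * t]] = pi ^+ n.+1 * e.
  elim: n => [|n [d [e [h1 h2]]]].
    have E0 x : (fiber F x).[b] = F.[b%:P].[x] by rewrite fiber_horner hornerC.
    rewrite /= hornerC E0; case: (taylor1 F.[b%:P] a (pi * t)) => r ->.
    rewrite -E0 hc; exists 0, (c + t * r).
    by split; ring.
  have En : (phi n.+1).[a + pi * t] = b + pi * (d - w * (pi ^+ n * e)).
    by rewrite /= hornerD hornerN hornerZ fiber_horner h2 h1 exprS; ring.
  rewrite En.
  case: (taylor2 (fiber F (a + pi * t)) (b + pi * d) (- w * (pi ^+ n.+1 * e))) => r.
  have -> : b + pi * d + - w * (pi ^+ n.+1 * e) = b + pi * (d - w * (pi ^+ n * e)).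
    by rewrite exprS; ring.
  move=> ->; rewrite -h1 h2 h1; case: (dF t d) => d' ->.
  exists (d - w * (pi ^+ n * e)), (- w * e * d' + pi ^+ n * (w ^+ 2 * e ^+ 2) * r).
  split => //.
  transitivity (pi ^+ n.+1 * e * (1 - w * (fiber F a)^`().[b]) +
    pi ^+ n.+2 * (- w * e * d' + pi ^+ n * (w ^+ 2 * e ^+ 2) * r)).
    by rewrite !exprS; ring.
  by rewrite hw subrr mulr0 add0r.
exists (phi L) => t u h.
case: (step L t) => d [e [h1 h2]].
rewrite exprS piL mulr0 mul0r h1 in h2; rewrite h1.
case: (taylor2 (fiber F (a + pi * t)) (b + pi * d) (pi * (u - d))) => r.
have -> : b + pi * d + pi * (u - d) = b + pi * u by ring.
rewrite h h2 add0r; case: (dF t d) => d' -> E.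
have {}E : pi * (u - d) * (1 + pi * (w * d' + w * (u - d) * r)) = 0.
  transitivity (w * ((((fiber F a)^`()).[b] + pi * d') * (pi * (u - d)) +
     (pi * (u - d)) ^+ 2 * r) + pi * (u - d) * (1 - w * ((fiber F a)^`()).[b])).
    by ring.
  by rewrite hw subrr -E !mulr0 addr0.
set v := pi * (u - d) in E *; set z := w * d' + _ in E.
(* [v] is the distance from the given root to the constructed one. The Taylor expansion gives
   [v * (1 + pi * z) = 0], and nilpotency of [pi] forces [v = 0]. *)
have vn k : v = (- (pi * z)) ^+ k * v.
  elim: k => [|k IH]; first by rewrite expr0 mul1r.
  rewrite exprSr -mulrA.
  suff -> : - (pi * z) * v = v by exact: IH.
  by apply/eqP; rewrite eq_sym -subr_eq0 -E; apply/eqP; ring.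
suff v0 : v = 0 by transitivity (b + pi * d + v); [rewrite /v; ring | rewrite v0 addr0].
by rewrite (vn L) exprNn exprMn piL mul0r mulr0 mul0r.
Qed.

(** * Gauss lemma and elimination *)

Lemma divp_coefs (p : {poly rat}) (h : {poly {poly rat}}) :
  (forall i, p %| h`_i) -> exists h', h = p%:P * h'.
Proof.
move=> ph; exists (\poly_(i < size h) (h`_i %/ p)); apply/polyP => i.
rewrite coefCM coef_poly; case: ltnP => [_|hi].
  by rewrite mulrC divpK.
by rewrite mulr0 nth_default.
Qed.

(* The minimal polynomial of a root of [c] is a prime factor of [c]: evaluating
   the coefficients at that root shows that it divides [h] or [k]. *)
Lemma gauss_factor (c : {poly rat}) (A h k : {poly {poly rat}}) :
  c != 0 -> c%:P * A = h * k ->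
  exists c1 c2 h' k', [/\ h = c1%:P * h', k = c2%:P * k' & A = h' * k'].
Proof.
move: {2}(size c) (leqnn (size c)) => n; elim: n c h k => [|n IH] c h k sc c0 E.
  by move: sc; rewrite leqn0 size_poly_eq0 (negbTE c0).
have [sc1|sc1] := leqP (size c) 1.
  have Ec := size1_polyC sc1; set a := c`_0 in Ec.
  have a0 : a != 0 by apply: contraNneq c0 => a0; rewrite Ec a0.
  exists c, 1, ((a^-1)%:P%:P * h), k; split.
  - by rewrite mulrA -polyCM Ec -polyCM mulfV // mul1r.
  - by rewrite mul1r.
  - by rewrite -mulrA -E mulrA -polyCM Ec -polyCM mulVf // mul1r.
have [al ral] : exists x : algC, root (map_poly ratr c) x.
  by apply/closed_rootP; rewrite size_map_poly; apply: contraTneq sc1 => ->.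
case: (minCpolyP al) => p [_ _] hp.
pose phi : {poly rat} -> algC := horner_eval al \o map_poly ratr.
have ph q : (phi q == 0) = (p %| q) by rewrite -hp.
have mz u : (map_poly phi u == 0) -> exists u', u = p%:P * u'.
  move=> /eqP /polyP u0; apply: divp_coefs => i; rewrite -ph.
  by have := u0 i; rewrite coef_map coef0 => /eqP.
have pc : p %| c by rewrite -hp.
case/dvdpP: pc => c' Ec.
have c'0 : c' != 0 by apply: contraNneq c0 => c'0; rewrite Ec c'0 mul0r.
have p0 : p != 0 by apply: contraNneq c0 => p0; rewrite Ec p0 mulr0.
have sp : (1 < size p)%N.
  have rp : root (map_poly ratr p) al by rewrite hp dvdpp.
  have := root_size_gt1 _ rp; rewrite map_poly_eq0 size_map_poly; exact.
have sc' : (size c' <= n)%N.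
  rewrite -ltnS (leq_trans _ sc) // Ec size_mul //.
  move: sp; case: (size p) => // -[|m] // _; rewrite !addnS /=.
  by rewrite ltnS leq_addr.
have pP0 : p%:P != 0 :> {poly {poly rat}} by rewrite polyC_eq0.
have /eqP : map_poly phi (h * k) = 0.
  have phc : phi c = 0 by apply/eqP; rewrite ph Ec dvdp_mull.
  have -> : map_poly phi (h * k) = (phi c)%:P * map_poly phi A.
    by rewrite -E rmorphM /= map_polyC.
  by rewrite phc mul0r.
rewrite rmorphM mulf_eq0 => /orP [] /mz [u Eu].
  case: (IH c' u k sc' c'0) => [|c1 [c2 [h' [k' [h1 h2 h3]]]]].
    by apply: (mulfI pP0); rewrite mulrA -polyCM [p * _]mulrC -Ec E Eu mulrA.
  exists (p * c1), c2, h', k'; split => //.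
  by rewrite Eu h1 polyCM mulrA.
case: (IH c' h u sc' c'0) => [|c1 [c2 [h' [k' [h1 h2 h3]]]]].
  by apply: (mulfI pP0); rewrite mulrA -polyCM [p * _]mulrC -Ec E Eu mulrCA.
exists c1, (p * c2), h', k'; split => //.
by rewrite Eu h2 polyCM mulrA.
Qed.

(* In [{poly {poly R}}] the outer variable is Y and the inner one X, so that
   [size] is 1 + the degree in Y and [sizeY] is 1 + the degree in X. *)
Definition const2 (R : nzRingType) (h : {poly {poly R}}) :=
  (size h <= 1)%N && (sizeY h <= 1)%N.

(** The exact degrees are included since they express that neither X2 nor Y2 divides the
    bihomogeneous form, a fact that setting X2 = Y2 = 1 would hide. *)
Definition irrXY d1 d2 (F : {poly {poly rat}}) :=
  [/\ size F = d2.+1, sizeY F = d1.+1 &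
      forall h k, F = h * k -> const2 h || const2 k].

Lemma const2P (R : nzRingType) (h : {poly {poly R}}) :
  const2 h -> exists a, h = a%:P%:P.
Proof.
case/andP => s1 s2; exists h`_0`_0; rewrite {1}(size1_polyC s1).
congr (_%:P); apply: size1_polyC.
exact: leq_trans (max_size_coefXY _ _) s2.
Qed.

Lemma irrXY_neq0 d1 d2 F : irrXY d1 d2 F -> F != 0.
Proof. by case=> s _ _; rewrite -size_poly_eq0 s. Qed.

Lemma sizeYM (h k : {poly {poly rat}}) : h != 0 -> k != 0 ->
  sizeY (h * k) = (sizeY h + sizeY k).-1.
Proof.
by move=> h0 k0; rewrite !sizeYE rmorphM /= size_mul // swapXY_eq0.
Qed.

(** A vanishing resultant gives a common factor of positive degree in Y, but divisibility holds only
    up to factors in X. The first use of [gauss_factor] identifies the gcd with [F] up to such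
    factors, and the second removes the factor in front of [G]. *)
Lemma resultant0_dvd d1 d2 F G : (0 < d2)%N -> irrXY d1 d2 F ->
  resultant F G = 0 -> exists H, G = H * F.
Proof.
move=> d20 irF /eqP; rewrite resultant_eq0 => sg.
have F0 := irrXY_neq0 irF.
case: irF => sF _ irF.
set g := gcdp F G in sg.
have /Pdiv.Idomain.dvdpP [[c q] /= c0 E] : g %| F by exact: dvdp_gcdl.
have /Pdiv.Idomain.dvdpP [[c3 r] /= c30 E3] : g %| G by exact: dvdp_gcdr.
rewrite -!mul_polyC in E E3.
case: (gauss_factor c0 E) => c1 [c2 [q' [g' [_ Eg EF]]]].
have g'0 : g' != 0 by apply: contraNneq F0 => g'0; rewrite EF g'0 mulr0.
have q'0 : q' != 0 by apply: contraNneq F0 => q'0; rewrite EF q'0 mul0r.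
have : const2 q'.
  have := irF _ _ EF; case/orP => // /andP [sg' _].
  have : (size g <= 1)%N.
    rewrite Eg mul_polyC (leq_trans (size_scale_leq _ _)) //.
  by rewrite leqNgt sg.
case/const2P => a Ea.
have a0 : a != 0 by apply: contraNneq q'0 => a0; rewrite Ea a0.
have E4 : (a%:P * c3)%:P * G = (r * c2%:P) * F.
  by rewrite polyCM -mulrA E3 Eg EF Ea; ring.
have ac0 : a%:P * c3 != 0 by rewrite mulf_neq0 // polyC_eq0.
case: (gauss_factor ac0 E4) => c4 [c5 [r' [F' [_ EF5 EG]]]].
have : const2 c5%:P.
  have := irF _ _ EF5; case/orP => // /andP [sF' _].
  have : (size F <= 1)%N.
    by rewrite EF5 mul_polyC (leq_trans (size_scale_leq _ _)).
  by rewrite sF; case: (d2) d20.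
case/const2P => b /polyC_inj Eb.
have b0 : b != 0 by apply: contraNneq F0 => b0; rewrite EF5 Eb b0 mul0r.
exists (r' * (b^-1)%:P%:P).
by rewrite EF5 Eb -mulrA [_ * (_ * F')]mulrA -!polyCM mulVf // mul1r.
Qed.

Lemma size_prod_le1 (R : idomainType) (I : finType) (E : I -> {poly R}) (w : I -> nat) :
  (forall i, (size (E i) <= (w i).+1)%N) ->
  (size (\prod_i E i)%R <= (\sum_i w i).+1)%N.
Proof.
move=> h; elim: (index_enum I) => [|i r IH]; first by rewrite !big_nil size_poly1.
rewrite !big_cons; apply: leq_trans (size_polyMleq _ _) _.
by move: (h i) IH; lia.
Qed.

(** Each product in the Leibniz formula takes one entry per row of the Sylvester matrix: deg G rows
    hold coefficients of [F] and deg F rows hold coefficients of [G]. *)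
Lemma size_resultant (R : idomainType) (F G : {poly {poly R}}) a b :
  (sizeY F <= a.+1)%N -> (sizeY G <= b.+1)%N ->
  (size (resultant F G) <= ((size G).-1 * a + (size F).-1 * b).+1)%N.
Proof.
move=> Fa Gb; rewrite /resultant /determinant.
apply: leq_trans (size_sum _ _ _) _; apply/bigmax_leqP => s _.
rewrite -signr_odd; case: (odd _); rewrite ?mulN1r ?size_polyN ?mul1r.
all: set S := Sylvester_mx F G.
all: pose w (i : 'I_((size G).-1 + (size F).-1)) := if split i is inl _ then a else b.
all: have -> : ((size G).-1 * a + (size F).-1 * b = \sum_i w i)%N.
1,3: rewrite big_split_ord /= (eq_bigr (fun=> a)); 
  last by (move=> i _; rewrite /w (unsplitK (inl i))).
1,2: rewrite sum_nat_const card_ord (eq_bigr (fun=> b)) ?sum_nat_const ?card_ord //;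
  by move=> i _; rewrite /w (unsplitK (inr i)).
all: apply: size_prod_le1 => i; rewrite Sylvester_mxE /w.
all: case: (split i) => k; rewrite mulrb; case: ifP => _; rewrite ?size_poly0 //.
all: by apply: leq_trans (max_size_coefXY _ _) _.
Qed.

(** The resultant in Y lies in the ideal generated by [F] and [G], so it vanishes at the abscissa of
    every common zero. If [G] does not involve Y, it serves as [R] itself. *)
Lemma bezout_elim d1 d2 (F G : {poly {poly rat}}) e1 e2 : (0 < d2)%N -> irrXY d1 d2 F ->
  (size G <= e2.+1)%N -> (sizeY G <= e1.+1)%N -> G != 0 ->
  (exists H, G = H * F) \/
  exists R : {poly rat}, [/\ R != 0, (size R <= (d1 * e2 + d2 * e1).+1)%N &
    forall x y, root (fiber F x) y -> root (fiber G x) y -> root R x].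
Proof.
move=> d20 irF sG yG G0; have [sF yF _] := irF.
have [sG1|sG1] := leqP (size G) 1.
  right; have EG := size1_polyC sG1; exists G`_0; split.
  - by rewrite -polyC_eq0 -EG.
  - apply: leq_trans (max_size_coefXY _ _) _; apply: leq_trans yG _.
    by rewrite ltnS (leq_trans _ (leq_addl _ _)) // leq_pmull.
  - move=> x y _; rewrite EG /fiber map_polyC /= !rootE hornerC.
    by rewrite coefC.
have [r0|r0] := eqVneq (resultant F G) 0.
  by left; apply: resultant0_dvd irF r0.
right; exists (resultant F G); split => //.
  have := @size_resultant _ F G d1 e1; rewrite yF sF => /(_ (leqnn _) yG) h.
  apply: leq_trans h _; rewrite ltnS leq_add // mulnC leq_mul //.
  by move: sG; case: (size G).
move=> x y; have sF1 : (1 < size F)%N by rewrite sF; case: (d2) d20.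
have [[u v] /= _ Euv] := resultant_in_ideal sF1 sG1.
rewrite !rootE => /eqP hF /eqP hG.
have := congr1 (fun q => (fiber q x).[y]) Euv.
rewrite /fiber rmorphD !rmorphM /= map_polyC /= !hornerE hF hG !mulr0 addr0.
by rewrite /horner_eval => ->.
Qed.

(** * Bihomogenization *)

(** The degree [n] is prescribed and not read off from [p]; a surplus appears as a power of [v]. *)
Definition homz (A M : nzRingType) (phi : A -> M) (u v : M) n (p : {poly A}) : M :=
  \sum_(i < n.+1) phi p`_i * u ^+ i * v ^+ (n - i).

Section Homz.
Variables (A M : comNzRingType) (phi : {rmorphism A -> M}) (u v : M).
Notation hz := (homz phi u v).

Lemma homzS n p c : hz n.+1 (p * 'X + c%:P) = u * hz n p + phi c * v ^+ n.+1.
Proof.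
rewrite /homz big_ord_recl /= coefD coefMX coefC /= add0r mulr1 subn0 addrC.
congr (_ + _); rewrite mulr_sumr; apply: eq_bigr => i _.
rewrite /bump leq0n add1n coefD coefMX coefC /= addr0 exprS subSS; ring.
Qed.

Lemma homzD n p q : hz n (p + q) = hz n p + hz n q.
Proof.
rewrite -big_split; apply: eq_bigr => i _ /=.
by rewrite coefD rmorphD /= !mulrDl.
Qed.

Lemma homzZ n c q : hz n (c *: q) = phi c * hz n q.
Proof.
rewrite mulr_sumr; apply: eq_bigr => i _.
by rewrite coefZ rmorphM /= !mulrA.
Qed.

Lemma homz_widen k m (q : {poly A}) : (size q <= m.+1)%N -> hz (k + m) q = v ^+ k * hz m q.
Proof.
move=> sq; have E : (k + m).+1 = (m.+1 + k)%N by rewrite addSn addnC.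
rewrite {1}/homz E big_split_ord /= mulr_sumr [X in _ + X]big1 ?addr0; last first.
  move=> i _; rewrite nth_default ?rmorph0 ?mul0r //.
  by apply: leq_trans sq _; rewrite leq_addr.
apply: eq_bigr => i _ /=; rewrite -addnBA; last by rewrite -ltnS.
by rewrite exprD; ring.
Qed.

Lemma homzM n m (p q : {poly A}) : (size p <= n.+1)%N -> (size q <= m.+1)%N ->
  hz n p * hz m q = hz (n + m) (p * q).
Proof.
move=> sp sq; elim: n p sp => [|n IH] p sp.
  rewrite (size1_polyC sp) mul_polyC homzZ.
  by rewrite /homz big_ord1 /= coefC /= !mulr1.
pose p' := drop_poly 1 p.
have Ep : p = p' * 'X + (p`_0)%:P.
  apply/polyP => i; rewrite coefD coefMX coefC coef_drop_poly.
  by case: i => [|i] /=; rewrite ?add0r // addr0 addn1.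
have sp' : (size p' <= n.+1)%N by rewrite size_drop_poly leq_subLR add1n.
rewrite Ep homzS mulrDl -mulrA IH // addSn mulrDl mulrAC mul_polyC homzD homzZ.
have -> : p' * 'X * q = p' * q * 'X + 0%:P by rewrite polyC0 addr0 mulrAC.
rewrite homzS rmorph0 mul0r addr0 -addSn (homz_widen n.+1 sq); ring.
Qed.

End Homz.

Notation mp4 := {mpoly rat[4]}.

Definition cM : {rmorphism rat -> mp4} := @mpolyC 4 rat.
(* Homogenizing first in Y, keeping X as a polynomial variable over [mp4], and
   then in X makes each step a special case of [homzM]. *)
Definition homY e2 (h : {poly {poly rat}}) : {poly mp4} :=
  homz (map_poly cM) ('X_vY1)%:P ('X_vY2)%:P e2 h.
Definition homXY e1 e2 (h : {poly {poly rat}}) : mp4 :=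
  homz idfun 'X_vX1 'X_vX2 e1 (homY e2 h).

Lemma homY_coef e2 h i : (homY e2 h)`_i =
  \sum_(j < e2.+1) cM h`_j`_i * 'X_vY1 ^+ j * 'X_vY2 ^+ (e2 - j).
Proof.
rewrite /homY /homz coef_sum; apply: eq_bigr => j _.
by rewrite -!rmorphXn -mulrA -polyCM coefMC coef_map /= mulrA.
Qed.

Lemma homXYE e1 e2 h : homXY e1 e2 h =
  \sum_(i < e1.+1) \sum_(j < e2.+1)
    cM h`_j`_i * 'X_vY1 ^+ j * 'X_vY2 ^+ (e2 - j) * 'X_vX1 ^+ i * 'X_vX2 ^+ (e1 - i).
Proof. by apply: eq_bigr => i _; rewrite homY_coef !mulr_suml. Qed.

Lemma size_homY e2 h : (size (homY e2 h) <= sizeY h)%N.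
Proof.
apply/leq_sizeP => i hi; rewrite homY_coef big1 // => j _.
rewrite nth_default ?rmorph0 ?mul0r //.
exact: leq_trans (max_size_coefXY _ _) hi.
Qed.

Lemma homXYM e1 e2 e1' e2' (h k : {poly {poly rat}}) :
  (sizeY h <= e1.+1)%N -> (size h <= e2.+1)%N ->
  (sizeY k <= e1'.+1)%N -> (size k <= e2'.+1)%N ->
  homXY e1 e2 h * homXY e1' e2' k = homXY (e1 + e1') (e2 + e2') (h * k).
Proof.
move=> h1 h2 k1 k2; rewrite /homXY homzM; last 2 first.
- exact: leq_trans (size_homY _ _) h1.
- exact: leq_trans (size_homY _ _) k1.
by congr (homz _ _ _ _ _); rewrite /homY homzM.
Qed.

(** A unit vanishes nowhere, whereas a form of positive degree in (X1, X2) vanishes at X1 = X2 = 0;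
    likewise for Y. *)
Lemma homXY_unit e1 e2 h : homXY e1 e2 h \is a GRing.unit -> e1 = 0%N /\ e2 = 0%N.
Proof.
move=> U.
have nz v : (homXY e1 e2 h).@[v] != 0.
  have : (homXY e1 e2 h).@[v] \is a GRing.unit by exact: rmorph_unit.
  by rewrite unitfE.
split; apply/eqP/negPn/negP; rewrite -lt0n => e0.
  have := nz (fun i => if (i < 2)%N then 0 else 1).
  rewrite homXYE rmorph_sum big1 ?eqxx //= => i _.
  rewrite rmorph_sum big1 // => j _; rewrite !rmorphM /= !rmorphXn /= !mevalXU /=.
  rewrite -!mulrA -exprD subnKC; last by rewrite -ltnS.
  by rewrite expr0n eqn0Ngt e0 /= !mulr0.
have := nz (fun i => if (i < 2)%N then 1 else 0).
rewrite homXYE rmorph_sum big1 ?eqxx //= => i _.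
rewrite rmorph_sum big1 // => j _; rewrite !rmorphM /= !rmorphXn /= !mevalXU /=.
rewrite -!mulrA [0 ^+ j * (_ * _)]mulrA -(exprD 0).
rewrite subnKC; last by rewrite -ltnS.
by rewrite expr0n eqn0Ngt e0 /= !mul0r !mulr0.
Qed.

Definition mon d1 d2 i j : 'X_{1..4} :=
  [multinom nth 0%N [:: i; d1 - i; j; d2 - j]%N k | k < 4].

Definition coef2 d1 d2 (f : {mpoly int[4]}) i j : int := f@_(mon d1 d2 i j).

Lemma sum_bihomogeneous (V : nmodType) d1 d2 (f : {mpoly int[4]}) (T : 'X_{1..4} -> V) :
  bihomogeneous d1 d2 f -> (forall m, m \notin msupp f -> T m = 0) ->
  \sum_(m <- msupp f) T m = \sum_(i < d1.+1) \sum_(j < d2.+1) T (mon d1 d2 i j).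
Proof.
move=> bf T0.
pose s := [seq mon d1 d2 (val p.1) (val p.2) | p <- enum (setT : {set 'I_d1.+1 * 'I_d2.+1})].
have -> : \sum_(i < d1.+1) \sum_(j < d2.+1) T (mon d1 d2 i j) = \sum_(m <- s) T m.
  rewrite pair_big /= big_map big_enum /=.
  by apply: eq_bigl => p; rewrite inE.
have us : uniq s.
  rewrite map_inj_uniq ?enum_uniq // => -[a b] [a' b'] /= /mnmP E.
  have := E vX1; have := E vY1; rewrite !mnmE /= => Eb Ea.
  by congr (_, _); apply: val_inj.
rewrite [RHS](bigID (mem (msupp f))) /= [X in _ + X]big1 ?addr0; last exact: T0.
rewrite -[RHS]big_filter; apply: perm_big; apply: uniq_perm.
- exact: msupp_uniq.
- exact: filter_uniq.
move=> m; rewrite mem_filter; case: (boolP (m \in msupp f)) => //= mf.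
have [E1 E2] := bf _ mf.
have l1 : (m vX1 < d1.+1)%N by rewrite -E1 ltnS leq_addr.
have l2 : (m vY1 < d2.+1)%N by rewrite -E2 ltnS leq_addr.
apply/esym/mapP; exists (Ordinal l1, Ordinal l2); first by rewrite mem_enum inE.
apply/mnmP => k; rewrite mnmE /=.
by case: k => -[|[|[|[|//]]]] lk /=; rewrite -?E1 -?E2 ?addKn;
  congr (m _); apply: val_inj.
Qed.

Lemma eval4E d1 d2 f x1 x2 y1 y2 : bihomogeneous d1 d2 f ->
  eval4 f x1 x2 y1 y2 = \sum_(i < d1.+1) \sum_(j < d2.+1)
    coef2 d1 d2 f i j * (x1 ^+ i * x2 ^+ (d1 - i)) * (y1 ^+ j * y2 ^+ (d2 - j)).
Proof.
move=> bf; rewrite /eval4 mevalE (sum_bihomogeneous bf); last first.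
  by move=> m mf; rewrite memN_msupp_eq0 // mul0r.
apply: eq_bigr => i _; apply: eq_bigr => j _.
rewrite /coef2 -mulrA; congr (_ * _).
rewrite !big_ord_recl big_ord0 !mnmE /= mulr1; ring.
Qed.

Definition dehom d1 d2 (R : nzRingType) (a : nat -> nat -> R) : {poly {poly R}} :=
  \poly_(j < d2.+1) \poly_(i < d1.+1) a i j.

Lemma dehom_coef d1 d2 (R : nzRingType) (a : nat -> nat -> R) i j :
  (i <= d1)%N -> (j <= d2)%N -> (dehom d1 d2 a)`_j`_i = a i j.
Proof. by move=> hi hj; rewrite coef_poly ltnS hj coef_poly ltnS hi. Qed.

Lemma size_dehom d1 d2 (R : nzRingType) (a : nat -> nat -> R) :
  (size (dehom d1 d2 a) <= d2.+1)%N.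
Proof. exact: size_poly. Qed.

Lemma sizeY_dehom d1 d2 (R : nzRingType) (a : nat -> nat -> R) :
  (sizeY (dehom d1 d2 a) <= d1.+1)%N.
Proof.
apply/bigmax_leqP => j _; rewrite coef_poly; case: ifP => _; last by rewrite size_poly0.
exact: size_poly.
Qed.

Lemma homXY_dehom d1 d2 f : bihomogeneous d1 d2 f ->
  map_mpoly (intr : int -> rat) f =
  homXY d1 d2 (dehom d1 d2 (fun i j => (coef2 d1 d2 f i j)%:~R)).
Proof.
move=> bf.
have -> : map_mpoly (intr : int -> rat) f =
    \sum_(m <- msupp f) (f@_m)%:~R *: 'X_[rat, m].
  apply/mpolyP => m; rewrite mcoeff_map_mpoly raddf_sum /=.
  have [mf|mf] := boolP (m \in msupp f).
    rewrite (bigD1_seq m) ?msupp_uniq //= mcoeffZ mcoeffX eqxx mulr1.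
    rewrite big1 ?addr0 // => m' /negbTE nm.
    by rewrite mcoeffZ mcoeffX nm mulr0.
  rewrite (memN_msupp_eq0 mf) big_seq big1 // => m' m'f.
  rewrite mcoeffZ mcoeffX; case: eqP => [E|]; last by rewrite mulr0.
  by rewrite -E m'f in mf.
rewrite (sum_bihomogeneous bf); last first.
  by move=> m mf; rewrite memN_msupp_eq0 // scale0r.
rewrite homXYE; apply: eq_bigr => i _; apply: eq_bigr => j _.
rewrite dehom_coef; try by rewrite -ltnS.
rewrite -!mulrA -mul_mpolyC; congr (_ * _).
rewrite mpolyXE_id !big_ord_recl big_ord0 !mnmE /= mulr1.
rewrite (_ : lift _ _ = vX2); last exact: val_inj.
rewrite (_ : lift _ _ = vY1); last exact: val_inj.
rewrite (_ : lift _ _ = vY2); last exact: val_inj.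
rewrite (_ : ord0 = vX1); last exact: val_inj.
ring.
Qed.

Lemma irreducible_irrXY d1 d2 f : (0 < d1)%N -> (0 < d2)%N ->
  bihomogeneous d1 d2 f -> irreducible_over_Q f ->
  irrXY d1 d2 (dehom d1 d2 (fun i j => (coef2 d1 d2 f i j)%:~R)).
Proof.
move=> d10 d20 bf; rewrite /irreducible_over_Q (homXY_dehom bf).
set F := dehom _ _ _ => -[f0 [_ irf]].
(* Complementary bidegrees for [h] and [k] turn a factorization of [F] into one of the form, in
   which one factor must be a unit. *)
have key e1 e2 h k : (e1 <= d1)%N -> (e2 <= d2)%N -> F = h * k ->
    (sizeY h <= e1.+1)%N -> (size h <= e2.+1)%N ->
    (sizeY k <= (d1 - e1).+1)%N -> (size k <= (d2 - e2).+1)%N ->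
    (e1 == 0)%N && (e2 == 0)%N || (e1 == d1) && (e2 == d2).
  move=> le1 le2 E h1 h2 k1 k2.
  have := homXYM h1 h2 k1 k2; rewrite !subnKC // -E => /esym /irf [] /homXY_unit [a b].
    by rewrite a b eqxx.
  by apply/orP; right; apply/andP; split; lia.
have F0 : F != 0.
  apply: contraNneq f0 => ->; rewrite homXYE big1 // => i _; rewrite big1 // => j _.
  by rewrite !coef0 rmorph0 !mul0r.
have sY1 : sizeY (1 : {poly {poly rat}}) = 1%N by rewrite sizeYE rmorph1 size_poly1.
have sF : size F = d2.+1.
  apply/eqP; rewrite eqn_leq size_dehom /= ltnNge; apply/negP => s.
  (* In bidegree (0, 1) the polynomial 1 homogenizes to Y2: a drop of the degree in Y would make Y2
     a proper factor. *)
  have := key d1 d2.-1 F 1; rewrite mulr1 subnn size_poly1 sY1.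
  rewrite (prednK d20) leqnn leq_pred sizeY_dehom s /= => /(_ isT isT erefl isT isT isT isT).
  by case/orP => /andP [/eqP e1 /eqP e2]; lia.
have yF : sizeY F = d1.+1.
  apply/eqP; rewrite eqn_leq sizeY_dehom /= ltnNge; apply/negP => s.
  have := key d1.-1 d2 F 1; rewrite mulr1 subnn size_poly1 sY1.
  rewrite (prednK d10) leqnn leq_pred size_dehom s /= => /(_ isT isT erefl isT isT isT isT).
  by case/orP => /andP [/eqP e1 /eqP e2]; lia.
split => // h k E.
have h0 : h != 0 by apply: contraNneq F0 => h0; rewrite E h0 mul0r.
have k0 : k != 0 by apply: contraNneq F0 => k0; rewrite E k0 mulr0.
have s1 := size_mul h0 k0; have s2 := sizeYM h0 k0.
rewrite -E sF in s1; rewrite -E yF in s2.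
have a1 : (0 < size h)%N by rewrite size_poly_gt0.
have a2 : (0 < size k)%N by rewrite size_poly_gt0.
have b1 : (0 < sizeY h)%N by rewrite lt0n sizeY_eq0.
have b2 : (0 < sizeY k)%N by rewrite lt0n sizeY_eq0.
rewrite /const2.
have := key (sizeY h).-1 (size h).-1 h k _ _ E _ _ _ _.
move: s1 s2 a1 a2 b1 b2; clear.
move: (size h) (size k) (sizeY h) (sizeY k) => a b c d; lia.
Qed.

(** * Congruence classes of points *)

Definition pt := ((int * int) * (int * int))%type.

Definition bev d1 d2 (R : nzRingType) (a : nat -> nat -> R) (x1 x2 y1 y2 : R) : R :=
  \sum_(i < d1.+1) \sum_(j < d2.+1)
    a i j * (x1 ^+ i * x2 ^+ (d1 - i)) * (y1 ^+ j * y2 ^+ (d2 - j)).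

(** The partial derivative in Y1 of the form evaluated by [bev]. At j = 0 the truncated [j.-1] is
    harmless because of the factor [*+ j]. *)
Definition bevd d1 d2 (R : nzRingType) (a : nat -> nat -> R) (x1 x2 y1 y2 : R) : R :=
  \sum_(i < d1.+1) \sum_(j < d2.+1)
    a i j * (x1 ^+ i * x2 ^+ (d1 - i)) * (y1 ^+ j.-1 * y2 ^+ (d2 - j)) *+ j.

Lemma bev_morph d1 d2 (R S : nzRingType) (f : {rmorphism R -> S}) a x1 x2 y1 y2 :
  f (bev d1 d2 a x1 x2 y1 y2) =
  bev d1 d2 (fun i j => f (a i j)) (f x1) (f x2) (f y1) (f y2).
Proof.
rewrite rmorph_sum; apply: eq_bigr => i _; rewrite rmorph_sum; apply: eq_bigr => j _.
by rewrite !rmorphM !rmorphXn.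
Qed.

Lemma bevd_morph d1 d2 (R S : nzRingType) (f : {rmorphism R -> S}) a x1 x2 y1 y2 :
  f (bevd d1 d2 a x1 x2 y1 y2) =
  bevd d1 d2 (fun i j => f (a i j)) (f x1) (f x2) (f y1) (f y2).
Proof.
rewrite rmorph_sum; apply: eq_bigr => i _; rewrite rmorph_sum; apply: eq_bigr => j _.
by rewrite rmorphMn !rmorphM !rmorphXn.
Qed.

Lemma fiber_dehom d1 d2 (R : comNzRingType) (a : nat -> nat -> R) x :
  fiber (dehom d1 d2 a) x = \poly_(j < d2.+1) \sum_(i < d1.+1) a i j * x ^+ i.
Proof.
apply/polyP => j; rewrite coef_map /= /horner_eval !coef_poly.
by case: ifP => _; rewrite ?horner_poly ?horner0.
Qed.

Lemma bev_dehom d1 d2 (R : comNzRingType) (a : nat -> nat -> R) x x2 y y2 :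
  bev d1 d2 a (x * x2) x2 (y * y2) y2 =
  x2 ^+ d1 * y2 ^+ d2 * (fiber (dehom d1 d2 a) x).[y].
Proof.
rewrite fiber_dehom horner_poly mulr_sumr /bev exchange_big; apply: eq_bigr => j _ /=.
rewrite mulr_suml mulr_sumr; apply: eq_bigr => i _; rewrite !exprMn.
have -> : x2 ^+ d1 = x2 ^+ i * x2 ^+ (d1 - i) by rewrite -exprD subnKC // -ltnS.
have -> : y2 ^+ d2 = y2 ^+ j * y2 ^+ (d2 - j) by rewrite -exprD subnKC // -ltnS.
by ring.
Qed.

Lemma bevd_dehom d1 d2 (R : comNzRingType) (a : nat -> nat -> R) x x2 y y2 :
  bevd d1 d2 a (x * x2) x2 (y * y2) y2 =
  x2 ^+ d1 * y2 ^+ d2.-1 * (fiber (dehom d1 d2 a) x)^`().[y].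
Proof.
rewrite fiber_dehom /bevd exchange_big big_ord_recl /= big1 ?add0r; last first.
  by move=> i _; rewrite mulr0n.
have -> : (\poly_(j < d2.+1) (\sum_(i < d1.+1) a i j * x ^+ i))^`() =
  \poly_(j < d2) ((\sum_(i < d1.+1) a i j.+1 * x ^+ i) *+ j.+1).
  apply/polyP => j; rewrite coef_deriv !coef_poly ltnS.
  by case: ifP; rewrite ?mul0rn.
rewrite horner_poly mulr_sumr; apply: eq_bigr => j _ /=.
rewrite mulrnAl mulrnAr mulr_suml mulr_sumr -sumrMnl; apply: eq_bigr => i _.
rewrite !exprMn /bump leq0n add1n /=; congr (_ *+ _).
have -> : x2 ^+ d1 = x2 ^+ i * x2 ^+ (d1 - i) by rewrite -exprD subnKC // -ltnS.
have -> : y2 ^+ d2.-1 = y2 ^+ j * y2 ^+ (d2 - j.+1).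
  by rewrite -exprD; congr (_ ^+ _); have := ltn_ord j; lia.
by ring.
Qed.

Lemma intrZ_eq0 m (z : int) : (1 < m)%N -> (z%:~R == 0 :> 'Z_m) = (m%:Z %| z)%Z.
Proof.
move=> m1; have N n : (n%:R == 0 :> 'Z_m) = (m %| n)%N.
  by rewrite -val_eqE /= val_Zp_nat.
case: z => n; first by rewrite dvdzE /= -N.
by rewrite NegzE rmorphN oppr_eq0 dvdzE abszN /= -N.
Qed.

Lemma intrZ_unit p L (z : int) : prime p -> (0 < L)%N -> ~~ (p%:Z %| z)%Z ->
  z%:~R \is a @GRing.unit 'Z_(p ^ L).
Proof.
move=> pp L0 nz; have m1 : (1 < p ^ L)%N by rewrite -(exp1n L) ltn_exp2r // prime_gt1.
have h : coprime (p ^ L) `|z| by rewrite coprimeXl // prime_coprime // -dvdzE.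
case: z nz h => n nz h; first by have := unitZpE n m1; rewrite h => ->.
by rewrite NegzE rmorphN unitrN; have := unitZpE n.+1 m1; rewrite h => ->.
Qed.

Lemma det_scale_rows (R : comPzRingType) s (r : 'I_s -> R) (M : 'I_s -> 'I_s -> R) :
  \det (\matrix_(k, j) (r k * M k j)) = (\prod_k r k) * \det (\matrix_(k, j) M k j).
Proof.
have -> : \matrix_(k, j) (r k * M k j) = diag_mx (\row_k r k) *m \matrix_(k, j) M k j.
  by apply/matrixP => k j; rewrite mul_diag_mx !mxE.
by rewrite det_mulmx det_diag; congr (_ * _); apply: eq_bigr => k _; rewrite mxE.
Qed.

Definition bevp d1 d2 (a : nat -> nat -> int) (P : pt) :=
  bev d1 d2 a P.1.1 P.1.2 P.2.1 P.2.2.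
Definition bevdp d1 d2 (a : nat -> nat -> int) (P : pt) :=
  bevd d1 d2 a P.1.1 P.1.2 P.2.1 P.2.2.

(** The conditions Hensel lifting asks for: both affine coordinates are p-integral, and modulo p the
    y-coordinate is a simple root. *)
Definition smooth_at p d1 d2 a (P : pt) :=
  [&& bevp d1 d2 a P == 0, ~~ (p%:Z %| P.1.2)%Z, ~~ (p%:Z %| P.2.2)%Z
    & ~~ (p%:Z %| bevdp d1 d2 a P)%Z].

(** Equality of the reductions in the projective line over F_p, written without choosing a chart. *)
Definition congP1 p (u v : int * int) := (p%:Z %| u.1 * v.2 - v.1 * u.2)%Z.
Definition cong p (P P' : pt) := congP1 p P.1 P'.1 && congP1 p P.2 P'.2.

Definition monval D e (i j : nat) (P : pt) : int :=
  P.1.1 ^+ i * P.1.2 ^+ (D - i) * (P.2.1 ^+ j * P.2.2 ^+ (e - j)).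

(** * One congruence class seen in Z / p ^ L, where p is nilpotent *)

Section Zp.
Variables (p L : nat).
Hypotheses (pp : prime p) (L0 : (0 < L)%N).
Let R := 'Z_(p ^ L).
Let pi : R := p%:R.

Let m1 : (1 < p ^ L)%N.
Proof. by rewrite -(exp1n L) ltn_exp2r // prime_gt1. Qed.

Let piL : pi ^+ L = 0.
Proof. by rewrite -natrX; apply/eqP; have := intrZ_eq0 (p ^ L)%N%:Z m1; rewrite dvdzz. Qed.

Let aff (u : int * int) : R := u.1%:~R / u.2%:~R.

Let affE u : ~~ (p%:Z %| u.2)%Z -> u.1%:~R = aff u * u.2%:~R.
Proof. by move=> h; rewrite divrK // intrZ_unit. Qed.

Let aff_cong u v : ~~ (p%:Z %| u.2)%Z -> ~~ (p%:Z %| v.2)%Z -> congP1 p u v ->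
  exists t, aff v = aff u + pi * t.
Proof.
move=> hu hv /dvdzP [q E]; exists (- q%:~R / (u.2%:~R * v.2%:~R)).
have U : (u.2%:~R * v.2%:~R : R) \is a GRing.unit.
  by rewrite unitrM !intrZ_unit.
have : (u.1 * v.2 - v.1 * u.2)%:~R = (q * p%:Z)%:~R :> R by rewrite E.
rewrite rmorphB !rmorphM /= (affE hu) (affE hv) -[p%:~R]/pi => E'.
apply: (mulIr U); rewrite mulrDl -[pi * _ * _]mulrA divrK // mulrN [pi * _]mulrC -E'; ring.
Qed.

Variables (d1 d2 : nat) (a : nat -> nat -> int).
Let F : {poly {poly R}} := dehom d1 d2 (fun i j => (a i j)%:~R).

Let smooth_fiber P : smooth_at p d1 d2 a P ->
  (fiber F (aff P.1)).[aff P.2] = 0 /\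
  ((fiber F (aff P.1))^`().[aff P.2] \is a GRing.unit).
Proof.
case/and4P => /eqP z h1 h2 h3.
have U1 := intrZ_unit pp L0 h1; have U2 := intrZ_unit pp L0 h2.
have U3 := intrZ_unit pp L0 h3; split.
  have := congr1 (fun n => n%:~R : R) z; rewrite /bevp (bev_morph _ _ intr) /=.
  rewrite (affE h1) (affE h2) bev_dehom => E; apply: (@mulrI _ (P.1.2%:~R ^+ d1 * P.2.2%:~R ^+ d2)).
    by rewrite unitrM !unitrX.
  by rewrite E mulr0.
move: U3; rewrite /bevdp (bevd_morph _ _ intr) /= (affE h1) (affE h2) bevd_dehom.
by rewrite unitrM => /andP [].
Qed.

Let lift_poly P0 : smooth_at p d1 d2 a P0 -> exists phi : {poly R}, forall P,
  smooth_at p d1 d2 a P -> cong p P0 P -> aff P.2 = phi.[aff P.1].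
Proof.
move=> s0; have [f0 fu] := smooth_fiber s0.
have f0' : (fiber F (aff P0.1)).[aff P0.2] = pi * 0 by rewrite f0 mulr0.
have [phi hphi] := hensel_poly piL (mulVr fu) f0'.
exists phi => P sP /andP [c1 c2].
case/and4P: (s0) => _ h1 h2 _; case/and4P: (sP) => _ h3 h4 _.
have [t Et] := aff_cong h1 h3 c1; have [u Eu] := aff_cong h2 h4 c2.
by have [fP _] := smooth_fiber sP; move: fP; rewrite Et Eu; apply: hphi.
Qed.

(** On a class the affine y is [phi] of the affine x, so equal x give equal y modulo [p ^ L]. As [L]
    is arbitrary, this becomes an equality once [p ^ L] exceeds the heights involved. *)
Lemma class_inj_mod P0 P : smooth_at p d1 d2 a P0 -> smooth_at p d1 d2 a P ->
  cong p P0 P -> P0.1 = P.1 -> ((p ^ L)%:Z %| P0.2.1 * P.2.2 - P.2.1 * P0.2.2)%Z.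
Proof.
move=> s0 sP c E; have [phi h] := lift_poly s0.
have c0 : cong p P0 P0 by rewrite /cong /congP1 !subrr !dvdz0.
have E2 : aff P.2 = aff P0.2 by rewrite (h _ sP c) (h _ s0 c0) E.
case/and4P: (s0) => _ _ h2 _; case/and4P: (sP) => _ _ h4 _.
rewrite -intrZ_eq0 // rmorphB !rmorphM /= (affE h2) (affE h4) E2.
by apply/eqP; ring.
Qed.

(** On the graph of [phi] a monomial becomes the one-variable polynomial [psi j], up to a factor
    depending only on the row. All abscissas are congruent modulo p, so [det_poly_nilp] applies. *)
Lemma class_det_mod D e s (P : 'I_s -> pt) (al be : 'I_s -> nat) P0 :
  (forall k, smooth_at p d1 d2 a (P k)) -> smooth_at p d1 d2 a P0 ->
  (forall k, cong p P0 (P k)) ->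
  (forall j, al j <= D)%N -> (forall j, be j <= e)%N -> (L <= 'C(s, 2))%N ->
  ((p ^ L)%:Z %| \det (\matrix_(k < s, j < s) monval D e (al j) (be j) (P k)))%Z.
Proof.
move=> sP s0 cP hal hbe Ls; have [phi h] := lift_poly s0.
rewrite -intrZ_eq0 // -(det_map_mx intr).
pose psi j := 'X^(al j) * phi ^+ be j.
case/and4P: (s0) => _ h1 h2 _.
have ht k : exists t, aff (P k).1 == aff P0.1 + pi * t.
  case/andP: (cP k) => c1 _; case/and4P: (sP k) => _ h3 _ _.
  by have [t ->] := aff_cong h1 h3 c1; exists t.
pose t k := xchoose (ht k).
have tP k : aff (P k).1 = aff P0.1 + pi * t k by apply/eqP; apply: (xchooseP (ht k)).
have -> : map_mx intr (\matrix_(k < s, j < s) monval D e (al j) (be j) (P k)) =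
  \matrix_(k, j) (((P k).1.2%:~R ^+ D * (P k).2.2%:~R ^+ e) *
      (psi j).[aff P0.1 + pi * t k]) :> 'M[R]_s.
  apply/matrixP => k j; rewrite !mxE /monval !rmorphM !rmorphXn /=.
  case/and4P: (sP k) => _ h3 h4 _.
  rewrite -tP (affE h3) (affE h4) hornerM hornerXn horner_exp -(h _ (sP k) (cP k)).
  set x2 := _.1.2%:~R; set y2 := _.2.2%:~R.
  have -> : x2 ^+ D = x2 ^+ al j * x2 ^+ (D - al j) by rewrite -exprD subnKC.
  have -> : y2 ^+ e = y2 ^+ be j * y2 ^+ (e - be j) by rewrite -exprD subnKC.
  move: (aff (P k).1) (aff (P k).2) x2 y2 => u v x2 y2; rewrite !exprMn; ring.
rewrite (det_scale_rows (fun k => (P k).1.2%:~R ^+ D * (P k).2.2%:~R ^+ e)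
  (fun k j => (psi j).[aff P0.1 + pi * t k])).
by rewrite (det_poly_nilp _ _ _ piL Ls) mulr0.
Qed.

End Zp.

(** * Auxiliary forms vanishing on a set of points *)

Lemma PoszX (b n : nat) : (b ^ n)%N%:Z = b%:Z ^+ n.
Proof. by rewrite -[LHS]natz natrX natz. Qed.

Lemma monval_le D e i j (P : pt) (b1 b2 : int) :
  `|P.1.1| <= b1 -> `|P.1.2| <= b1 -> `|P.2.1| <= b2 -> `|P.2.2| <= b2 ->
  (i <= D)%N -> (j <= e)%N -> `|monval D e i j P| <= b1 ^+ D * b2 ^+ e.
Proof.
move=> h1 h2 h3 h4 hi hj.
have b10 : 0 <= b1 by apply: le_trans h1.
have b20 : 0 <= b2 by apply: le_trans h3.
have -> : b1 ^+ D * b2 ^+ e = b1 ^+ i * b1 ^+ (D - i) * (b2 ^+ j * b2 ^+ (e - j)).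
  by rewrite -!exprD !subnKC.
have lX (x b : int) n : 0 <= b -> `|x| <= b -> `|x| ^+ n <= b ^+ n.
  by move=> b0 xb; apply: lerXn2r; rewrite ?nnegrE.
by rewrite /monval !normrM !normrX !ler_pM ?mulr_ge0 ?exprn_ge0 ?lX.
Qed.

Notation monoms D e := ('I_(D.+1) * 'I_(e.+1))%type.

Lemma bevp_sum D e (cc : nat -> nat -> int) P :
  bevp D e cc P = \sum_(k < #|{: monoms D e}|)
     monval D e (enum_val k).1 (enum_val k).2 P * cc (enum_val k).1 (enum_val k).2.
Proof.
rewrite /bevp /bev pair_big /=.
rewrite -(big_enum_val (fun k : monoms D e => monval D e k.1 k.2 P * cc k.1 k.2)) /=.
apply: eq_big => [k|k _]; first by rewrite unfold_in.
by rewrite [RHS]mulrC /monval !mulrA.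
Qed.

(** Used in two situations: in bidegree (d1, d2), where the minors vanish because the given form is
    in the kernel, and in bidegree (D, d2 - 1), where they vanish because they are divisible by a
    power of p that exceeds their size. *)
Lemma vanishing_form D e (K : seq pt) (B : int) (s := #|{: monoms D e}|) :
  1 <= B ->
  (forall P i j, P \in K -> (i <= D)%N -> (j <= e)%N -> `|monval D e i j P| <= B) ->
  (forall Pf : 'I_s -> pt, (forall k, Pf k \in K) ->
     \det (\matrix_(k < s, j < s) monval D e (enum_val j).1 (enum_val j).2 (Pf k)) = 0) ->
  exists cc : nat -> nat -> int,
    [/\ exists i j, [/\ (i <= D)%N, (j <= e)%N & cc i j != 0],
        forall P, P \in K -> bevp D e cc P = 0
      & forall i j, `|cc i j| <= (s%:R * B) ^+ s].
Proof.
move=> B1 hB hdet; pose P0 : pt := ((0, 0), (0, 0)).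
pose A : 'M[int]_(size K, s) := \matrix_(k < size K, j < s)
  monval D e (enum_val j).1 (enum_val j).2 (nth P0 K k).
have hA i j : `|A i j| <= B.
  by rewrite mxE; apply: hB; rewrite ?mem_nth // -ltnS.
have hd (g : 'I_s -> 'I_(size K)) : \det (rowsub g A) = 0.
  rewrite -(hdet (fun k => nth P0 K (g k))); last by move=> k; rewrite mem_nth.
  by congr (\det _); apply/matrixP => i j; rewrite !mxE.
have [c [[j0 cj0] Ac cB]] := small_kernel B1 hA hd.
(* Out of range, [inord] defaults to 0, so the bound on [cc] holds for all i and j. *)
pose cc i j := c (enum_rank (inord i : 'I_D.+1, inord j : 'I_e.+1)).
have ccE (k : 'I_s) : cc (enum_val k).1 (enum_val k).2 = c k.
  by rewrite /cc !inord_val -surjective_pairing enum_valK.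
exists cc; split.
- by exists (enum_val j0).1, (enum_val j0).2; split; rewrite ?ccE // -ltnS ltn_ord.
- move=> P PK; rewrite bevp_sum.
  have lt : (index P K < size K)%N by rewrite index_mem.
  rewrite -[RHS](Ac (Ordinal lt)); apply: eq_bigr => k _.
  by rewrite mxE /= nth_index // ccE.
- by move=> i j; apply: cB.
Qed.

(** * Affine coordinates of rational points, and the bound for one class *)

Lemma P1_rep_inj (u v : int * int) : P1_rep u.1 u.2 -> P1_rep v.1 v.2 ->
  u.1 * v.2 = v.1 * u.2 -> u = v.
Proof.
case: u v => [x y] [x' y'] /= /andP [cxy hx] /andP [cxy' hx'] E.
have dx : (x %| x')%Z by rewrite -(Gauss_dvdzl _ cxy) -E dvdz_mulr.
have dx' : (x' %| x)%Z by rewrite -(Gauss_dvdzl _ cxy') E dvdz_mulr.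
have Ex : x = x'.
  have := dx; have := dx'; rewrite !dvdzE => d1 d2.
  have : `|x|%N = `|x'|%N by apply/eqP; rewrite eqn_dvd d1 d2.
  by case/orP: hx => [|/andP [/eqP -> _]]; case/orP: hx' => [|/andP [/eqP -> _]]; lia.
move: hx hx' E; rewrite -Ex => /orP [x0 _ /(mulfI (lt0r_neq0 x0)) -> //|].
by case/andP => /eqP -> /eqP -> /orP [|/andP [_ /eqP -> //]]; rewrite ltxx.
Qed.

Definition xi (u : int * int) : rat := u.1%:~R / u.2%:~R.

Lemma xiE u : u.2 != 0 -> u.1%:~R = xi u * u.2%:~R.
Proof. by move=> h; rewrite /xi divfK // intr_eq0. Qed.

Lemma xi_inj u v : P1_rep u.1 u.2 -> P1_rep v.1 v.2 -> u.2 != 0 -> v.2 != 0 ->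
  xi u = xi v -> u = v.
Proof.
move=> ru rv hu hv E; apply: P1_rep_inj => //.
apply: (@intr_inj rat); rewrite !rmorphM /= (xiE hu) (xiE hv) E; ring.
Qed.

Notation dehomQ d1 d2 a := (dehom d1 d2 (fun i j => (a i j)%:~R : rat)).

Lemma root_fiber d1 d2 a P : P.1.2 != 0 -> P.2.2 != 0 -> bevp d1 d2 a P = 0 ->
  root (fiber (dehomQ d1 d2 a) (xi P.1)) (xi P.2).
Proof.
move=> h1 h2 /(congr1 (fun n => n%:~R : rat)); rewrite /bevp (bev_morph _ _ intr) /=.
rewrite (xiE h1) (xiE h2) bev_dehom => /eqP.
by rewrite !mulf_eq0 !expf_eq0 !intr_eq0 (negbTE h1) (negbTE h2) !andbF.
Qed.

Lemma root_fiber_deriv d1 d2 a P : P.1.2 != 0 -> P.2.2 != 0 -> bevdp d1 d2 a P = 0 ->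
  root (fiber (dehomQ d1 d2 a)^`() (xi P.1)) (xi P.2).
Proof.
move=> h1 h2 /(congr1 (fun n => n%:~R : rat)); rewrite /bevdp (bevd_morph _ _ intr) /=.
rewrite (xiE h1) (xiE h2) bevd_dehom fiber_deriv => /eqP.
by rewrite !mulf_eq0 !expf_eq0 !intr_eq0 (negbTE h1) (negbTE h2) !andbF.
Qed.

Lemma dehomQ_neq0 d1 d2 a i j : (i <= d1)%N -> (j <= d2)%N -> a i j != 0 ->
  dehomQ d1 d2 a != 0.
Proof.
move=> hi hj; apply: contraNneq => /(congr1 (fun q : {poly {poly rat}} => q`_j`_i)).
by rewrite dehom_coef // !coef0 => /eqP; rewrite intr_eq0.
Qed.

Definition valid b1 b2 (P : pt) :=
  [&& P1_rep P.1.1 P.1.2, P1_rep P.2.1 P.2.2, (height P.1.1 P.1.2 <= b1)%N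
    & (height P.2.1 P.2.2 <= b2)%N].

Lemma valid_le b1 b2 P : valid b1 b2 P ->
  [/\ `|P.1.1| <= b1%:Z, `|P.1.2| <= b1%:Z, `|P.2.1| <= b2%:Z & `|P.2.2| <= b2%:Z].
Proof. by case/and4P => _ _; rewrite /height !geq_max => /andP [? ?] /andP [? ?]; split; lia. Qed.

(** The points of [K] are determined by x. The finite x are roots of [R], fewer than [size R], and
    the point at infinity accounts for one more. *)
Lemma xi_count (K : seq pt) (R : {poly rat}) b1 b2 : R != 0 -> uniq K ->
  (forall P, P \in K -> valid b1 b2 P) ->
  (forall P P', P \in K -> P' \in K -> P.1 = P'.1 -> P.2 = P'.2) ->
  (forall P, P \in K -> P.1.2 != 0 -> root R (xi P.1)) ->
  (size K <= size R)%N.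
Proof.
move=> R0 uK vK iK rK.
rewrite -(count_predC (fun P : pt => P.1.2 != 0)).
have l1 : (count (fun P : pt => P.1.2 != 0) K < size R)%N.
  rewrite -size_filter -(size_map (fun P => xi P.1)).
  apply: max_poly_roots => //.
    apply/allP => x /mapP [P]; rewrite mem_filter => /andP [h PK] ->; exact: rK.
  rewrite map_inj_in_uniq ?filter_uniq // => P P'.
  rewrite !mem_filter => /andP [h PK] /andP [h' PK'] E.
  have E1 : P.1 = P'.1.
    by case/and4P: (vK _ PK) => r1 _ _ _; case/and4P: (vK _ PK') => r2 _ _ _; apply: xi_inj.
  by rewrite (surjective_pairing P) (surjective_pairing P') E1 (iK _ _ PK PK' E1).
have l2 : (count (predC (fun P : pt => P.1.2 != 0)) K <= 1)%N.
  rewrite -size_filter; set q := predC _.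
  case E : [seq _ <- _ | _] => [|P [|P' l]] //.
  have : P \in [seq x <- K | q x] by rewrite E mem_head.
  rewrite mem_filter /= negbK => /andP [hP PK].
  have : P' \in [seq x <- K | q x] by rewrite E !in_cons eqxx orbT.
  rewrite mem_filter /= negbK => /andP [hP' PK'].
  have E1 : P.1 = P'.1.
    case/and4P: (vK _ PK) => r1 _ _ _; case/and4P: (vK _ PK') => r2 _ _ _.
    by apply: P1_rep_inj => //; rewrite (eqP hP) (eqP hP') !mulr0.
  have := filter_uniq q uK; rewrite E /= in_cons.
  rewrite (surjective_pairing P) (surjective_pairing P') E1 (iK _ _ PK PK' E1).
  by rewrite eqxx.
by apply: leq_trans (leq_add (leqnn _) l2) _; rewrite addn1.
Qed.

(** The degree [d2.-1] in Y is what prevents the auxiliary form from being a multiple of the given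
    one. The successor in the bound is for the point x = infinity. *)
Lemma class_card d1 d2 a p D b1 b2 (K : seq pt)
  (s := #|{: monoms D d2.-1}|) :
  (0 < d2)%N -> irrXY d1 d2 (dehomQ d1 d2 a) -> (0 < b1)%N -> (0 < b2)%N ->
  ((s * (b1 ^ D * b2 ^ d2.-1)) ^ s < p ^ 'C(s, 2))%N ->
  uniq K -> (forall P, P \in K -> valid b1 b2 P) ->
  (forall P, P \in K -> bevp d1 d2 a P = 0) ->
  (forall P, P \in K -> P.2.2 != 0) ->
  (forall P P', P \in K -> P' \in K -> P.1 = P'.1 -> P.2 = P'.2) ->
  (forall Pf : 'I_s -> pt, (forall k, Pf k \in K) -> ((p ^ 'C(s, 2))%:Z %|
     \det (\matrix_(k < s, j < s) monval D d2.-1 (enum_val j).1 (enum_val j).2 (Pf k)))%Z) ->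
  (size K <= (d1 * d2.-1 + d2 * D).+1)%N.
Proof.
move=> d20 irF b10 b20 hp uK vK zK nK iK dK.
pose B : int := (b1 ^ D * b2 ^ d2.-1)%N%:Z.
have hB P i j : P \in K -> (i <= D)%N -> (j <= d2.-1)%N -> `|monval D d2.-1 i j P| <= B.
  move=> /vK /valid_le [h1 h2 h3 h4] hi hj.
  by rewrite /B PoszM !PoszX; apply: monval_le.
have B1 : 1 <= B.
  by rewrite /B lez_nat muln_gt0 !expn_gt0 b10 b20.
have [|cc [[i0 [j0 [hi0 hj0 c0]]] zG _]] := vanishing_form B1 hB.
  move=> Pf PfK; apply/eqP/negPn/negP => nz.
  (* A nonzero determinant would be at least [p ^ 'C(s, 2)] in absolute value, against [hp]. *)
  have := dK _ PfK; rewrite dvdzE /= => /dvdn_leq; rewrite absz_gt0 => /(_ nz).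
  rewrite leqNgt => /negP []; apply: leq_ltn_trans hp.
  rewrite -lez_nat; set M := \matrix_(_, _) _ in nz *.
  have : `|\det M| <= s`!%:R * B ^+ s.
    by apply: norm_det_le => k j; rewrite mxE; apply: hB; rewrite // -ltnS.
  rewrite -abszE; move=> h; apply: le_trans h _.
  rewrite expnMn PoszM [((_ * _) ^ s)%N%:Z]PoszX -/B natz; apply: ler_pM => //.
    by rewrite exprn_ge0.
  by rewrite lez_nat; apply: fact_leq_exp.
pose G := dehomQ D d2.-1 cc.
have sG : (size G <= d2.-1.+1)%N by apply: size_dehom.
have yG : (sizeY G <= D.+1)%N by apply: sizeY_dehom.
have G0 : G != 0 by apply: dehomQ_neq0 hi0 hj0 c0.
have [[H EG]|[R [R0 sR rR]]] := bezout_elim d20 irF sG yG G0.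
  have H0 : H != 0 by apply: contraNneq G0 => H0; rewrite EG H0 mul0r.
  have [sF _ _] := irF; move: sG; rewrite EG size_mul ?(irrXY_neq0 irF) // sF.
  by have : (0 < size H)%N; [rewrite size_poly_gt0 | move: (size H) => n; lia].
apply: leq_trans sR; apply: (@xi_count _ _ b1 b2) => // P PK nP.
by apply: (rR _ (xi P.2)); apply: root_fiber; rewrite ?nK ?zK ?zG.
Qed.

(** * The number of classes modulo p *)

Lemma intrF_eq0 p (z : int) : prime p -> (z%:~R == 0 :> 'F_p) = (p%:Z %| z)%Z.
Proof.
move=> pp; have N n : (n%:R == 0 :> 'F_p) = (p %| n)%N.
  by rewrite (dvdn_pcharf (pchar_Fp pp)).
case: z => n; first by rewrite dvdzE /= -N.
by rewrite NegzE rmorphN oppr_eq0 dvdzE abszN /= -N.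
Qed.

Section Chart.
Variables (p d1 d2 : nat) (a : nat -> nat -> int) (K : seq pt) (kap : nat).
Hypotheses (pp : prime p) (smK : forall P, P \in K -> smooth_at p d1 d2 a P).

Let aff (u : int * int) : 'F_p := u.1%:~R / u.2%:~R.

Let affE u : ~~ (p%:Z %| u.2)%Z -> u.1%:~R = aff u * u.2%:~R.
Proof. by move=> h; rewrite /aff divfK // intrF_eq0. Qed.

Let aff_cong u v : ~~ (p%:Z %| u.2)%Z -> ~~ (p%:Z %| v.2)%Z -> aff u = aff v ->
  congP1 p u v.
Proof.
move=> hu hv E; rewrite /congP1 -intrF_eq0 // rmorphB !rmorphM /= (affE hu) (affE hv) E.
by apply/eqP; ring.
Qed.

Let F : {poly {poly 'F_p}} := dehom d1 d2 (fun i j => (a i j)%:~R).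

Let smooth_root P : P \in K ->
  root (fiber F (aff P.1)) (aff P.2) && (fiber F (aff P.1) != 0).
Proof.
move=> /smK /and4P [/eqP z h1 h2 h3]; apply/andP; split.
  have := congr1 (fun n => n%:~R : 'F_p) z; rewrite /bevp (bev_morph _ _ intr) /=.
  rewrite (affE h1) (affE h2) bev_dehom => /eqP.
  by rewrite !mulf_eq0 !expf_eq0 !intrF_eq0 // (negbTE h1) (negbTE h2) !andbF.
move: h3; rewrite -intrF_eq0 // /bevdp (bevd_morph _ _ intr) /=.
rewrite (affE h1) (affE h2) bevd_dehom; apply: contraNneq => ->.
by rewrite deriv0 horner0 mulr0.
Qed.

Hypothesis class_kap : forall K', {subset K' <= K} -> uniq K' ->
  (forall P P', P \in K' -> P' \in K' -> cong p P P') -> (size K' <= kap)%N.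

(** There are p residues for x. Over a residue that occurs, the fibre modulo p is a nonzero
    polynomial, its derivative being nonzero at a smooth point, so it has at most [d2] roots. *)
Lemma chart_card : uniq K -> (size K <= p * d2 * kap)%N.
Proof.
move=> uK; pose f P := (aff P.1, aff P.2).
have kf u : (\sum_(P <- K | f P == u) 1 <= kap)%N.
  rewrite sum1_count -size_filter; apply: class_kap.
  - by move=> P; rewrite mem_filter => /andP [].
  - exact: filter_uniq.
  move=> P P'; rewrite !mem_filter => /andP [/eqP e1 PK] /andP [/eqP e2 PK'].
  case/and4P: (smK PK) => _ h1 h2 _; case/and4P: (smK PK') => _ h3 h4 _.
  have e3 := congr1 fst (etrans e1 (esym e2)); have e4 := congr1 snd (etrans e1 (esym e2)).
  by rewrite /cong !aff_cong.
rewrite -sum1_size (partition_big f predT) //=.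
apply: leq_trans (_ : \sum_(u : 'F_p * 'F_p | u \in map f K) kap <= _)%N.
  rewrite [X in (_ <= X)%N]big_mkcond /=; apply: leq_sum => u _.
  case: ifP => [_|/negbT nu]; first exact: kf.
  rewrite big_seq_cond big1 // => P /andP [PK /eqP E].
  by rewrite -E map_f in nu.
have -> : (\sum_(u : 'F_p * 'F_p | u \in map f K) kap =
    \sum_(x : 'F_p) \sum_(y : 'F_p | (x, y) \in map f K) kap)%N.
  by rewrite pair_big_dep; apply: eq_bigl => -[x y].
apply: leq_trans (_ : \sum_(x : 'F_p) d2 * kap <= _)%N; last first.
  by rewrite sum_nat_const card_Fp // mulnA.
apply: leq_sum => x _; rewrite sum_nat_const leq_mul2r; apply/orP; right.
have [/hasP [P PK /eqP Ex]|/hasPn nh] := boolP (has (fun P => aff P.1 == x) K); last first.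
  rewrite (@eq_card0 _ _) // => y; apply/negP => /mapP [P PK /(congr1 fst) /= Ex].
  by have := nh P PK; rewrite -Ex eqxx.
have /andP [_ nz] := smooth_root PK.
rewrite cardE -ltnS; apply: leq_trans (_ : size (fiber F (aff P.1)) <= _)%N.
  apply: max_poly_roots => //; last exact: enum_uniq.
  apply/allP => y; rewrite mem_enum => /mapP [P' PK' E].
  have /= E1 := congr1 fst E; have /= E2 := congr1 snd E.
  by have /andP [] := smooth_root PK'; rewrite -E1 -E2 Ex.
by apply: leq_trans (size_poly _ _) _; rewrite size_dehom.
Qed.

End Chart.

(* Exchanging x1 and x2 handles the points with p | x2. *)
Definition swp (sw : bool) (P : pt) : pt := if sw then ((P.1.2, P.1.1), P.2) else P.
Definition swa (sw : bool) d1 (a : nat -> nat -> int) i j :=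
  if sw then a (d1 - i)%N j else a i j.

Lemma swpK sw : involutive (swp sw).
Proof. by case: sw => [[[x1 x2] y]|]. Qed.

Lemma bevp_swap sw d1 d2 a P : bevp d1 d2 (swa sw d1 a) (swp sw P) = bevp d1 d2 a P.
Proof.
case: sw => //; rewrite /bevp /bev [RHS](reindex_inj rev_ord_inj) /=.
apply: eq_bigr => i _; apply: eq_bigr => j _; rewrite /swa subSS subKn //; last by rewrite -ltnS.
by rewrite [X in a _ _ * X]mulrC.
Qed.

Lemma bevdp_swap sw d1 d2 a P : bevdp d1 d2 (swa sw d1 a) (swp sw P) = bevdp d1 d2 a P.
Proof.
case: sw => //; rewrite /bevdp /bevd [RHS](reindex_inj rev_ord_inj) /=.
apply: eq_bigr => i _; apply: eq_bigr => j _; rewrite /swa subSS subKn //; last by rewrite -ltnS.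
by rewrite [X in a _ _ * X]mulrC.
Qed.

Lemma monval_swap sw D e i j P : (i <= D)%N ->
  monval D e i j P = monval D e (if sw then D - i else i)%N j (swp sw P).
Proof.
by move=> iD; case: sw => //; rewrite /monval /swp /= subKn // [X in X * _ = _]mulrC.
Qed.

Lemma dvdz_small (m : nat) (z : int) : (m%:Z %| z)%Z -> (`|z| < m)%N -> z = 0.
Proof.
rewrite dvdzE /= => /dvdn_leq; rewrite absz_gt0; case: eqP => // _ /(_ isT).
by rewrite leqNgt => /negP.
Qed.

(** * Points at which p does not divide the derivative in Y1 *)

Section Good.
Variables (d1 d2 D b1 b2 p : nat) (a : nat -> nat -> int).
Let s := #|{: monoms D d2.-1}|.
Hypotheses (d20 : (0 < d2)%N) (irF : irrXY d1 d2 (dehomQ d1 d2 a)).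
Hypotheses (b10 : (0 < b1)%N) (b20 : (0 < b2)%N) (pp : prime p) (D0 : (0 < D)%N).
Hypothesis hp : ((s * (b1 ^ D * b2 ^ d2.-1)) ^ s < p ^ 'C(s, 2))%N.
Let kap := (d1 * d2.-1 + d2 * D).+1.

Let C0 : (0 < 'C(s, 2))%N.
Proof.
rewrite bin_gt0 /s card_prod !card_ord; case: (D) D0 => // n _.
by rewrite mulSn; lia.
Qed.

Let class_bound sw (K : seq pt) : uniq K ->
  (forall P, P \in K -> valid b1 b2 P) ->
  (forall P, P \in K -> smooth_at p d1 d2 (swa sw d1 a) (swp sw P)) ->
  (forall P P', P \in K -> P' \in K -> cong p (swp sw P) (swp sw P')) ->
  (size K <= kap)%N.
Proof.
move=> uK vK sK cK.
have y20 P : P \in K -> P.2.2 != 0.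
  move=> /sK /and4P [_ _ h _]; apply: contraNneq h => z.
  by case: (sw); rewrite /swp /= z dvdz0.
apply: (class_card d20 irF b10 b20 hp uK vK _ y20).
- by move=> P /sK /and4P [/eqP]; rewrite bevp_swap.
- move=> P P' PK PK' E; have [/and4P [_ r _ _] /and4P [_ r' _ _]] := (vK _ PK, vK _ PK').
  have [_ _ h1 h2] := valid_le (vK _ PK); have [_ _ h3 h4] := valid_le (vK _ PK').
  apply: P1_rep_inj => //; apply/eqP; rewrite -subr_eq0; apply/eqP.
  (* The cross product of two y-coordinates is at most [2 * b2 ^ 2], which is less than [L], hence
     less than [p ^ L]; being divisible by [p ^ L], it is 0. *)
  pose L := (2 * b2 ^ 2).+1.
  apply: (@dvdz_small (p ^ L)%N).
    have := class_inj_mod pp (ltn0Sn _ : (0 < L)%N) (sK _ PK) (sK _ PK') (cK _ _ PK PK').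
    by case: (sw) => /=; rewrite E; apply.
  apply: leq_ltn_trans (ltn_expl _ (prime_gt1 pp)); rewrite -lez_nat abszE.
  apply: le_trans (ler_normB _ _) _; rewrite !normrM.
  have l1 : `|P.2.1| * `|P'.2.2| <= b2%:Z * b2%:Z by apply: ler_pM.
  have l2 : `|P'.2.1| * `|P.2.2| <= b2%:Z * b2%:Z by apply: ler_pM.
  have -> : L%:Z = b2%:Z * b2%:Z + b2%:Z * b2%:Z + 1 by rewrite /L; lia.
  by apply: le_trans (lerD l1 l2) _; rewrite lerDl.
move=> Pf PfK.
have s0 : (0 < s)%N by rewrite lt0n; apply: contraTneq C0 => ->.
set P0 := Pf (Ordinal s0).
(* Exchanging x1 and x2 exchanges the exponents i and [D - i], so the determinant at the swapped
   points is the required one. *)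
pose al (j : 'I_s) : nat := if sw then (D - (enum_val j).1)%N else (enum_val j).1.
pose be (j : 'I_s) : nat := (enum_val j).2.
have := @class_det_mod p _ pp C0 d1 d2 (swa sw d1 a) D d2.-1 s (fun k => swp sw (Pf k)) al be (swp sw P0).
move=> /(_ (fun k => sK _ (PfK k)) (sK _ (PfK _)) (fun k => cK _ _ (PfK _) (PfK k))).
have hal j : (al j <= D)%N.
  by rewrite /al; case: (sw); rewrite ?leq_subr // -ltnS.
have hbe j : (be j <= d2.-1)%N by exact: (ltn_ord (enum_val j).2).
move=> /(_ hal hbe (leqnn _)); congr (is_true (_ %| \det _)%Z).
apply/matrixP => k j; rewrite !mxE /al /be [RHS](monval_swap sw) //.
exact: (ltn_ord (enum_val j).1).
Qed.

Let good_chart sw (K : seq pt) : uniq K ->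
  (forall P, P \in K -> valid b1 b2 P) ->
  (forall P, P \in K -> smooth_at p d1 d2 (swa sw d1 a) (swp sw P)) ->
  (size K <= p * d2 * kap)%N.
Proof.
move=> uK vK sK; rewrite -(size_map (swp sw)).
apply: (@chart_card p d1 d2 (swa sw d1 a)) => //.
- by move=> P /mapP [P' PK ->]; apply: sK.
- move=> K' sub uK' cK'; rewrite -(size_map (swp sw)).
  have sub' P : P \in map (swp sw) K' -> P \in K.
    by case/mapP => P' /sub /mapP [Q QK ->] ->; rewrite swpK.
  apply: (@class_bound sw).
  + by rewrite (map_inj_uniq (inv_inj (swpK sw))).
  + by move=> P /sub' /vK.
  + by move=> P /sub' /sK.
  + by move=> P P' /mapP [Q QK ->] /mapP [Q' QK' ->]; rewrite !swpK; apply: cK'.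
by rewrite (map_inj_uniq (inv_inj (swpK sw))).
Qed.

(* Euler's identity: [y1 * f_Y1 = d2 * f] modulo [y2]. *)
Let euler P : exists z, P.2.1 * bevdp d1 d2 a P = d2%:Z * bevp d1 d2 a P - P.2.2 * z.
Proof.
exists (\sum_(i < d1.+1) \sum_(j < d2.+1)
  a i j * (P.1.1 ^+ i * P.1.2 ^+ (d1 - i)) * (P.2.1 ^+ j * P.2.2 ^+ (d2 - j).-1) *+ (d2 - j)).
rewrite /bevdp /bevd /bevp /bev !mulr_sumr -sumrB; apply: eq_bigr => i _.
rewrite !mulr_sumr -sumrB; apply: eq_bigr => j _.
set u := _ * _ ^+ (d1 - i); set y1 := P.2.1; set y2 := P.2.2.
have E1 : y1 * (y1 ^+ j.-1 *+ j) = y1 ^+ j *+ j.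
  by case: (nat_of_ord j) => [|n]; rewrite ?mulr0n ?mulr0 // mulrnAr -exprS.
have E2 : y2 * (y2 ^+ (d2 - j).-1 *+ (d2 - j)) = y2 ^+ (d2 - j) *+ (d2 - j).
  by case: (d2 - j)%N => [|n]; rewrite ?mulr0n ?mulr0 // mulrnAr -exprS.
have -> : y1 * (a i j * u * (y1 ^+ j.-1 * y2 ^+ (d2 - j)) *+ j) =
  a i j * u * y2 ^+ (d2 - j) * (y1 * (y1 ^+ j.-1 *+ j)).
  by rewrite !mulrnAr; congr (_ *+ _); ring.
have -> : y2 * (a i j * u * (y1 ^+ j * y2 ^+ (d2 - j).-1) *+ (d2 - j)) =
  a i j * u * y1 ^+ j * (y2 * (y2 ^+ (d2 - j).-1 *+ (d2 - j))).
  by rewrite !mulrnAr; congr (_ *+ _); ring.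
have -> : d2%:Z = j%:Z + (d2 - j)%N%:Z by rewrite -PoszD subnKC // -ltnS.
by rewrite E1 E2 !mulrnAr -(mulr_natr _ j) -(mulr_natr _ (d2 - j)) !natz; ring.
Qed.

(** Only x needs two charts: if p divided y2, Euler's identity would make it divide y1 times the
    derivative, hence the derivative, as y1 and y2 are coprime. *)
Lemma good_card (K : seq pt) : uniq K ->
  (forall P, P \in K -> valid b1 b2 P) ->
  (forall P, P \in K -> bevp d1 d2 a P = 0) ->
  (forall P, P \in K -> ~~ (p%:Z %| bevdp d1 d2 a P)%Z) ->
  (size K <= 2 * (p * d2 * kap))%N.
Proof.
move=> uK vK zK gK.
have cop u v : coprimez u v -> (p%:Z %| u)%Z -> ~~ (p%:Z %| v)%Z.
  move=> c pu; apply/negP => pv; have : (p%:Z %| gcdz u v)%Z by rewrite dvdz_gcd pu pv.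
  rewrite (eqP c) dvdzE /= dvdn1 => /eqP p1; by have := prime_gt1 pp; rewrite p1.
have y2 P : P \in K -> ~~ (p%:Z %| P.2.2)%Z.
  move=> PK; have /and4P [_ /andP [c _] _ _] := vK _ PK; apply/negP => py2.
  have [z E] := euler P; move: E; rewrite zK // mulr0 sub0r => E.
  have : (p%:Z %| P.2.1 * bevdp d1 d2 a P)%Z by rewrite E rpredN dvdz_mulr.
  rewrite Gauss_dvdzr ?(negbTE (gK _ PK)) //.
  have : ~~ (p%:Z %| P.2.1)%Z by apply: (cop P.2.2) => //; rewrite coprimez_sym.
  by rewrite dvdzE /= => h; rewrite /coprimez /gcdz eqz_nat -/(coprime _ _) prime_coprime.
pose q (P : pt) := (p%:Z %| P.1.2)%Z.
rewrite -(count_predC q) mul2n -addnn -!size_filter; apply: leq_add.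
  apply: (@good_chart true); first exact: filter_uniq.
    by move=> P; rewrite mem_filter => /andP [_ /vK].
  move=> P; rewrite mem_filter => /andP [qP PK].
  rewrite /smooth_at bevp_swap bevdp_swap (zK _ PK) eqxx (gK _ PK) /= (y2 _ PK) ?andbT.
  by have /and4P [/andP [c _] _ _ _] := vK _ PK; apply: cop qP; rewrite coprimez_sym.
apply: (@good_chart false); first exact: filter_uniq.
  by move=> P; rewrite mem_filter => /andP [_ /vK].
move=> P; rewrite mem_filter => /andP [qP PK].
by rewrite /smooth_at bevp_swap bevdp_swap (zK _ PK) eqxx (gK _ PK) /= (y2 _ PK) ?andbT.
Qed.

End Good.

(** * Counting points *)

Lemma size_le_fibers (T U : eqType) (f : T -> U) (K : seq T) (L : seq U) kap :
  (forall x, x \in K -> f x \in L) ->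
  (forall u, (count (fun x => f x == u) K <= kap)%N) -> (size K <= size L * kap)%N.
Proof.
elim: L K => [|u L IH] K fK cK.
  by case: K fK {cK} => // x K /(_ x); rewrite mem_head => /(_ isT).
rewrite -(count_predC (fun x => f x == u)) /= mulSn leq_add // -size_filter.
apply: IH => [x|w].
  by rewrite mem_filter /= => /andP [/negbTE nu /fK]; rewrite in_cons nu.
apply: leq_trans (cK w); rewrite count_filter; apply: sub_count => x /=.
by case/andP.
Qed.

(** Otherwise X - x would divide every coefficient of [F] and be a nontrivial factor. *)
Lemma fiber_neq0 d1 d2 F x : (0 < d2)%N -> irrXY d1 d2 F -> fiber F x != 0.
Proof.
move=> d20 irF; have F0 := irrXY_neq0 irF; have [sF _ hF] := irF.
apply/negP => /eqP f0.
have dv i : ('X - x%:P) %| F`_i.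
  rewrite dvdp_XsubCl rootE; have := congr1 (fun q : {poly rat} => q`_i) f0.
  by rewrite coef_map coef0 /= /horner_eval => ->.
have [k Ek] := divp_coefs dv.
have k0 : k != 0 by apply: contraNneq F0 => k0; rewrite Ek k0 mulr0.
have := hF _ _ Ek; case/orP => /andP [h1 h2].
  move: h2; rewrite leqNgt => /negP []; apply: (@leq_trans (size ('X - x%:P))).
    by rewrite size_XsubC.
  by have := max_size_coefXY ('X - x%:P)%:P 0; rewrite coefC.
have : (size F <= 1)%N by rewrite Ek mul_polyC (leq_trans (size_scale_leq _ _)).
by rewrite sF; case: (d2) d20.
Qed.

Lemma bev_x20 d1 d2 (R : comNzRingType) (a : nat -> nat -> R) x1 y1 y2 :
  bev d1 d2 a x1 0 y1 y2 = x1 ^+ d1 * \sum_(j < d2.+1) a d1 j * (y1 ^+ j * y2 ^+ (d2 - j)).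
Proof.
rewrite /bev big_ord_recr /= big1 ?add0r => [|i _].
  by rewrite mulr_sumr; apply: eq_bigr => j _; rewrite subnn mulr1; ring.
rewrite big1 // => j _; rewrite expr0n subn_eq0 leqNgt ltn_ord.
by rewrite !mulr0 mul0r.
Qed.

Lemma bev_y20 d1 d2 (R : comNzRingType) (a : nat -> nat -> R) x1 x2 y1 :
  bev d1 d2 a x1 x2 y1 0 = y1 ^+ d2 * \sum_(i < d1.+1) a i d2 * (x1 ^+ i * x2 ^+ (d1 - i)).
Proof.
rewrite /bev mulr_sumr; apply: eq_bigr => i _.
rewrite big_ord_recr /= big1 ?add0r => [|j _]; last first.
  by rewrite expr0n subn_eq0 leqNgt ltn_ord !mulr0.
by rewrite subnn; ring.
Qed.

Lemma hom1_root n (c : nat -> int) u : u.2 != 0 ->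
  \sum_(i < n.+1) c i * (u.1 ^+ i * u.2 ^+ (n - i)) = 0 ->
  root (\poly_(i < n.+1) ((c i)%:~R : rat)) (xi u).
Proof.
move=> u2 /(congr1 (fun z => z%:~R : rat)); rewrite rmorph_sum rmorph0 /= => E.
have u2n : (u.2%:~R : rat) ^+ n != 0 by rewrite expf_neq0 // intr_eq0.
rewrite rootE -(mulIr_eq0 _ (mulIf u2n)) horner_poly mulr_suml; apply/eqP; rewrite -[RHS]E.
apply: eq_bigr => i _; rewrite !rmorphM !rmorphXn /= (xiE u2).
have -> : (u.2%:~R : rat) ^+ n = u.2%:~R ^+ i * u.2%:~R ^+ (n - i).
  by rewrite -exprD subnKC // -ltnS.
by move: (xi u) => w; rewrite exprMn; ring.
Qed.

Lemma P1_rep_inf u : P1_rep u.1 u.2 -> u.2 = 0 -> u = (1, 0).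
Proof.
case: u => x y /= /andP [c h] y0; subst y; congr (_, _).
move: c h; rewrite /coprimez /gcdz gcdn0 => /eqP; lia.
Qed.

Lemma vertical_line_card (K : seq pt) (q : {poly rat}) :
  q != 0 -> uniq K ->
  (forall P P', P \in K -> P' \in K -> P.1 = P'.1) ->
  (forall P, P \in K -> [/\ P1_rep P.2.1 P.2.2, P.2.2 != 0 & root q (xi P.2)]) ->
  (size K < size q)%N.
Proof.
move=> q0 uK xK qK; rewrite -(size_map (fun P : pt => xi P.2)).
apply: max_poly_roots => //.
  by apply/allP => x /mapP [P /qK [_ _ r] ->].
rewrite map_inj_in_uniq // => P P' PK PK' E.
rewrite (surjective_pairing P) (surjective_pairing P') (xK _ _ PK PK').
have [r1 n1 _] := qK _ PK; have [r2 n2 _] := qK _ PK'.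
by rewrite (xi_inj r1 r2 n1 n2 E).
Qed.

(** The three terms count, in order: the points with both coordinates finite, over at most [n] roots
    of [R] with at most [d2] points each; the points with y at infinity, x being a root of the
    leading coefficient in Y or infinity; and the points with only x at infinity. *)
Lemma bezout_card d1 d2 a n (R : {poly rat}) b1 b2 (K : seq pt) :
  (0 < d2)%N -> irrXY d1 d2 (dehomQ d1 d2 a) -> R != 0 -> (size R <= n.+1)%N ->
  uniq K -> (forall P, P \in K -> valid b1 b2 P) ->
  (forall P, P \in K -> bevp d1 d2 a P = 0) ->
  (forall P, P \in K -> P.1.2 != 0 -> P.2.2 != 0 -> root R (xi P.1)) ->
  (size K <= n * d2 + d1.+1 + d2)%N.
Proof.
move=> d20 irF R0 sR uK vK zK rK.
have [sF yF _] := irF.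
have rep1 P : P \in K -> P1_rep P.1.1 P.1.2 by move/vK => /and4P [].
have rep2 P : P \in K -> P1_rep P.2.1 P.2.2 by move/vK => /and4P [].
pose qy (P : pt) := P.2.2 == 0.
pose qx (P : pt) := P.1.2 == 0.
rewrite -(count_predC qy) -!size_filter.
set K1 := filter qy K; set K2 := filter (predC qy) K.
have K1P P : P \in K1 -> [/\ P \in K, P.2 = (1, 0) & P.2.2 = 0].
  rewrite mem_filter => /andP [/eqP h PK]; split => //; apply: P1_rep_inf h; exact: rep2.
have K2P P : P \in K2 -> P \in K /\ P.2.2 != 0.
  by rewrite mem_filter => /andP [? ?]; split.
have uK1 : uniq K1 by apply: filter_uniq.
have uK2 : uniq K2 by apply: filter_uniq.
have l1 : (size K1 <= d1.+1)%N.
  have R1 : (\poly_(i < d1.+1) ((a i d2)%:~R : rat)) != 0.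
    have -> : \poly_(i < d1.+1) ((a i d2)%:~R : rat) = (dehomQ d1 d2 a)`_d2.
      by rewrite coef_poly ltnSn.
    by have := irrXY_neq0 irF; rewrite -lead_coef_eq0 lead_coefE sF.
  apply: leq_trans (size_poly _ _); apply: (@xi_count _ _ b1 b2 R1 uK1).
  - by move=> P /K1P [/vK].
  - by move=> P P' /K1P [_ -> _] /K1P [_ -> _].
  move=> P /K1P [PK P2 y2] x2; apply: (@hom1_root d1 (fun i => a i d2)) => //.
  by have := zK _ PK; rewrite /bevp y2 bev_y20 P2 expr1n mul1r.
rewrite -(count_predC qx K2) -!size_filter.
have l2 : (size (filter qx K2) <= d2)%N.
  have R2 : (\poly_(j < d2.+1) ((a d1 j)%:~R : rat)) != 0.
    apply/negP => /eqP z.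
    suff : (sizeY (dehomQ d1 d2 a) <= d1)%N by rewrite yF ltnn.
    apply/bigmax_leqP => j _; have ljd : (j < d2.+1)%N by rewrite -sF.
    apply/leq_sizeP => i di; rewrite coef_poly ljd coef_poly.
    case: ltnP => // li; have -> : i = d1 by lia.
    by have := congr1 (fun q : {poly rat} => q`_j) z; rewrite coef_poly ljd coef0.
  rewrite -ltnS; apply: leq_trans (size_poly d2.+1 (fun j => (a d1 j)%:~R : rat)).
  have KxP P : P \in filter qx K2 -> [/\ P \in K, P.2.2 != 0 & P.1 = (1, 0)].
    rewrite mem_filter => /andP [/eqP h /K2P [PK y2]]; split => //.
    by apply: P1_rep_inf h; apply: rep1.
  apply: vertical_line_card => //; first exact: filter_uniq.
    by move=> P P' /KxP [_ _ ->] /KxP [_ _ ->].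
  move=> P /KxP [PK y2 h]; split => //.
    exact: rep2.
  apply: (@hom1_root d2 (fun j => a d1 j)) => //.
  have := zK _ PK; rewrite /bevp h /= bev_x20.
  by rewrite expr1n mul1r.
have l3 : (size (filter (predC qx) K2) <= n * d2)%N.
  set K3 := filter _ _.
  have K3P P : P \in K3 -> [/\ P \in K, P.2.2 != 0 & P.1.2 != 0].
    by rewrite mem_filter => /andP [h /K2P []].
  have uK3 : uniq K3 by apply: filter_uniq.
  pose L := undup (map (fun P => xi P.1) K3).
  apply: (@leq_trans (size L * d2)).
    apply: (@size_le_fibers _ _ (fun P => xi P.1)).
      by move=> P PK; rewrite mem_undup; apply: map_f.
    move=> x; rewrite -size_filter -ltnS.
    have K4P P : P \in [seq P <- K3 | xi P.1 == x] ->
        [/\ P \in K, P.2.2 != 0, P.1.2 != 0 & xi P.1 = x].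
      by rewrite mem_filter => /andP [/eqP e /K3P []].
    apply: (@leq_trans (size (fiber (dehomQ d1 d2 a) x))).
      apply: vertical_line_card => //.
      - exact: fiber_neq0 irF.
      - exact: filter_uniq.
      - move=> P P' /K4P [PK _ h e1] /K4P [PK' _ h' e2].
        by apply: xi_inj; rewrite ?rep1 // e1.
      move=> P /K4P [PK y2 x2 e]; split => //.
        exact: rep2.
      by rewrite -e; apply: root_fiber => //; apply: zK.
    by apply: leq_trans (size_poly _ _) _; rewrite size_dehom.
  rewrite leq_mul2r -ltnS; apply/orP; right; apply: leq_trans sR.
  apply: max_poly_roots (undup_uniq _) => //.
  by apply/allP => x; rewrite mem_undup => /mapP [P /K3P [PK y2 x2] ->]; apply: rK.
have := leq_add l1 (leq_add l2 l3); move: (size K1) (size _) (size _) => *; lia.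
Qed.

(* If every prime p of the range divided [v x] for more than half of the [x],
   the product of the [v x] ^ 2 would exceed [X ^ (2 * size N)]. *)
Lemma good_prime (T : eqType) (N : seq T) (v : T -> nat) X a b :
  (0 < X)%N -> (forall x, x \in N -> (0 < v x <= X)%N) -> (X ^ 2 < primorial a b)%N ->
  exists p, [/\ prime p, (a < p <= b)%N & (size N <= 2 * count (fun x => ~~ (p %| v x)%N) N)%N].
Proof.
move=> X0 vN hX.
pose g p := prime p && (size N <= 2 * count (fun x => ~~ (p %| v x)%N) N)%N.
have [/hasP [p]|/hasPn nh] := boolP (has g (index_iota a.+1 b.+1)).
  rewrite mem_index_iota ltnS => pab /andP [pp h]; by exists p.
exfalso.
have nh' p : (a < p < b.+1)%N -> prime p ->
    (size N < 2 * count (fun x => (p %| v x)%N) N)%N.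
  move=> pab pp; have := nh p; rewrite mem_index_iota pab => /(_ isT).
  rewrite /g pp /= -ltnNge.
  have := count_predC (fun x => (p %| v x)%N) N; rewrite /predC /=.
  by move: (count _ _) (count _ _) => u w; lia.
(* For empty [N] every prime would be good, so the range would contain none and its primorial would
   be 1. *)
have N0 : (0 < size N)%N.
  rewrite lt0n; apply/negP => /eqP sN.
  suff E : primorial a b = 1%N by move: hX; rewrite E; lia.
  rewrite /primorial big_nat_cond big1 // => p /andP [pab pp].
  have := nh' p pab pp; have := count_size (fun x => (p %| v x)%N) N; lia.
have hX' : ((X ^ 2) ^ size N < primorial a b ^ size N)%N by rewrite ltn_exp2r.
have : (primorial a b ^ size N <= (X ^ 2) ^ size N)%N; last by rewrite leqNgt hX'.
rewrite /primorial (big_morph (expn^~ (size N)) (fun x y => expnMn x y _) (exp1n _)).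
pose W := (\prod_(a.+1 <= p < b.+1 | prime p) p ^ count (fun x => p %| v x) N)%N.
apply: (@leq_trans (W ^ 2)).
  rewrite /W (big_morph (expn^~ 2) (fun x y => expnMn x y _) (exp1n _)).
  rewrite big_nat_cond [X in (_ <= X)%N]big_nat_cond; apply: leq_prod => p.
  case/andP => pab pp; rewrite -expnM leq_exp2l ?prime_gt1 // mulnC ltnW //.
  exact: nh'.
rewrite -expnM mulnC expnM leq_exp2r //.
(* Exchanging the products, each x contributes the product of distinct primes dividing [v x], hence
   at most [X]. *)
have -> : W = (\prod_(x <- N) \prod_(a.+1 <= p < b.+1 | prime p && (p %| v x)) p)%N.
  rewrite (exchange_big_dep prime) /=; last by move=> x p _ /andP [].
  apply: eq_bigr => p pp; rewrite pp /= big_const_seq iter_muln muln1.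
  by [].
elim: (N) vN => [|x M IH] vM; first by rewrite big_nil.
rewrite big_cons /= expnS leq_mul ?IH // => [|y yM]; last first.
  by apply: vM; rewrite in_cons yM orbT.
have /andP [v0 vX] := vM x (mem_head _ _); apply: leq_trans vX.
by apply: dvdn_leq => //; apply: prod_primes_dvd => p.
Qed.

Lemma leq_expn2r a b n : (a <= b -> a ^ n <= b ^ n)%N.
Proof. by case: n => // n ab; rewrite leq_exp2r. Qed.

(** Squaring and taking an s-th root leaves a comparison with [p ^ s.-1], where s - 1 = D d2 + d2 -
    1. The constant 16 is 4 * 4: one factor 4 per exponent pays for [s ^ 2], the other for the power
    of [b2]. The part D d2 of the exponent pays for [b1 ^ (2 * D)]. *)
Lemma det_beats_size D d2 b1 b2 Q p (s := (D.+1 * d2)%N) :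
  (0 < D)%N -> (0 < d2)%N -> (b2 <= 2 ^ D)%N -> (0 < b1)%N ->
  (16 ^ d2 * b1 ^ 2 <= Q ^ d2)%N -> (Q < p)%N ->
  ((s * (b1 ^ D * b2 ^ d2.-1)) ^ s < p ^ 'C(s, 2))%N.
Proof.
move=> D0 d20 hb2 b10 hQ Qp.
have Es : s = (D * d2 + d2.-1).+1 by rewrite /s; lia.
have Q16 : (16 <= Q)%N.
  rewrite -(@leq_exp2r _ _ d2) //; apply: leq_trans hQ.
  by rewrite leq_pmulr // expn_gt0 b10.
have ss : (s <= 2 ^ s.-1)%N by rewrite Es /=; apply: ltn_expl.
have h1 : ((b2 ^ d2.-1) ^ 2 <= 4 ^ s.-1)%N.
  apply: (@leq_trans (((2 ^ D) ^ d2.-1) ^ 2)); first by rewrite leq_exp2r // leq_expn2r.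
  have -> : (((2 ^ D) ^ d2.-1) ^ 2 = 4 ^ (D * d2.-1))%N.
    by rewrite -!expnM mulnA mulnC (expnM 2 2).
  by rewrite leq_exp2l // Es /= (leq_trans _ (leq_addr _ _)) // leq_mul2l leq_pred orbT.
have h2 : (16 ^ s.-1 * (b1 ^ D) ^ 2 < p ^ s.-1)%N.
  have -> : s.-1 = (d2 * D + d2.-1)%N by rewrite Es /= mulnC.
  rewrite !expnD -mulnA [(16 ^ d2.-1 * _)%N]mulnC mulnA.
  apply: (@leq_ltn_trans (Q ^ (d2 * D) * Q ^ d2.-1)).
    apply: leq_mul; last by rewrite leq_expn2r.
    have -> : (16 ^ (d2 * D) * (b1 ^ D) ^ 2 = (16 ^ d2 * b1 ^ 2) ^ D)%N.
      by rewrite expnMn -!expnM [(D * 2)%N]mulnC.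
    by rewrite expnM leq_expn2r.
  rewrite -!expnD ltn_exp2r //; lia.
have h3 : ((s * (b1 ^ D * b2 ^ d2.-1)) ^ 2 < p ^ s.-1)%N.
  apply: leq_ltn_trans h2.
  have -> : ((s * (b1 ^ D * b2 ^ d2.-1)) ^ 2 = s ^ 2 * (b2 ^ d2.-1) ^ 2 * (b1 ^ D) ^ 2)%N.
    by rewrite !expnMn [((b1 ^ D) ^ 2 * _)%N]mulnC mulnA.
  apply: leq_mul => //; rewrite (expnMn 4 4); apply: leq_mul => //.
  have -> : (4 ^ s.-1 = (2 ^ s.-1) ^ 2)%N by rewrite -expnM mulnC expnM.
  by rewrite leq_exp2r.
have E2 : ('C(s, 2) * 2 = s.-1 * s)%N.
  by have := mul_bin_diag s 1; rewrite bin1 => E; rewrite mulnC -E mulnC.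
set Y := (s * _)%N in h3 *.
rewrite -(@ltn_exp2r _ _ 2) // -!expnM E2 [(s * 2)%N]mulnC expnM [X in (_ < X)%N]expnM.
by rewrite ltn_exp2r // Es.
Qed.

Lemma irrXY_scale d1 d2 F (c : rat) : c != 0 -> irrXY d1 d2 F ->
  irrXY d1 d2 (c%:P%:P * F).
Proof.
move=> c0 irF; have F0 := irrXY_neq0 irF; case: irF => sF yF hF.
have cP0 : c%:P%:P != 0 :> {poly {poly rat}} by rewrite !polyC_eq0.
have sYc (b : rat) : b != 0 -> sizeY b%:P%:P = 1%N.
  by move=> b0; rewrite sizeYE swapXY_polyC map_polyC size_polyC polyC_eq0 b0.
have sc (b : rat) h : b != 0 -> h != 0 -> const2 (b%:P%:P * h) = const2 h.
  move=> b0 h0; have bP0 : b%:P%:P != 0 :> {poly {poly rat}} by rewrite !polyC_eq0.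
  by rewrite /const2 size_mul // sizeYM // sYc // size_polyC polyC_eq0 b0.
split.
- by rewrite size_mul // size_polyC polyC_eq0 c0 sF.
- by rewrite sizeYM // sYc // yF.
move=> h k E; have : F = (c^-1)%:P%:P * h * k.
  by rewrite -mulrA -E mulrA -!polyCM mulVf // mul1r.
move=> EF; have := hF _ _ EF; rewrite sc ?invr_eq0 //.
by apply: contraNneq F0 => h0; rewrite EF h0 mulr0 mul0r.
Qed.

Lemma dehomQ_coef_neq0 d1 d2 a : dehomQ d1 d2 a != 0 ->
  exists i j, [/\ (i <= d1)%N, (j <= d2)%N & a i j != 0].
Proof.
set F := dehomQ d1 d2 a => F0.
have j0 : (0 < size F)%N by rewrite size_poly_gt0.
have jd : ((size F).-1 <= d2)%N by have := size_dehom d1 d2 (fun i j => (a i j)%:~R : rat); rewrite -/F; lia.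
have : lead_coef (lead_coef F) != 0 by rewrite !lead_coef_eq0.
rewrite lead_coefE; set i := (size _).-1; rewrite lead_coefE => nz.
have id : (i <= d1)%N.
  have := leq_trans (max_size_coefXY F (size F).-1) (sizeY_dehom d1 d2 (fun i j => (a i j)%:~R : rat)).
  by rewrite /i lead_coefE; lia.
exists i, (size F).-1; split => //.
by move: nz; rewrite dehom_coef // intr_eq0.
Qed.

Lemma bevdp_le d1 d2 a (P : pt) (b1 b2 : nat) (c : int) :
  (0 < b2)%N -> valid b1 b2 P -> (forall i j, `|a i j| <= c) ->
  `|bevdp d1 d2 a P| <=
    (d1.+1 * d2.+1 * d2)%N%:Z * (c * (b1 ^ d1 * b2 ^ d2)%N%:Z).
Proof.
move=> b20 /valid_le [h1 h2 h3 h4] hc.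
set B := (b1 ^ d1 * b2 ^ d2)%N%:Z.
have c0 : 0 <= c by apply: le_trans (hc 0%N 0%N).
rewrite /bevdp /bevd pair_big /=; apply: le_trans (ler_norm_sum _ _ _) _.
apply: le_trans (_ : \sum_(p : 'I_d1.+1 * 'I_d2.+1) d2%:Z * (c * B) <= _).
  apply: ler_sum => -[i j] _ /=.
  rewrite -mulr_natl natz normrM; apply: ler_pM => //.
    by have := ltn_ord j; lia.
  rewrite -mulrA normrM; apply: ler_pM => //.
  (* At j = 0 the truncated exponent leaves a monomial of degree d2 in Y instead of d2 - 1, so it is
     bounded separately. *)
  case: (posnP j) => [j0|j0].
    have := @monval_le d1 d2 i 0 P b1 b2 h1 h2 h3 h4 _ (leq0n _); rewrite -ltnS => /(_ (ltn_ord i)).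
    by rewrite /monval /B PoszM !PoszX j0.
  have := @monval_le d1 d2.-1 i j.-1 P b1 b2 h1 h2 h3 h4.
  rewrite -ltnS ltn_ord => /(_ isT).
  have jd : (j.-1 <= d2.-1)%N by have := ltn_ord j; lia.
  move=> /(_ jd) h; have Ej : (d2.-1 - j.-1 = d2 - j)%N by clear -j0 jd; have := ltn_ord j; lia.
  rewrite /monval {}Ej in h; apply: le_trans h _; rewrite /B PoszM !PoszX.
  by apply: ler_wpM2l; rewrite ?exprn_ge0 // -!PoszX lez_nat leq_pexp2l // leq_pred.
rewrite sumr_const card_prod !card_ord -mulr_natl natz mulrA -PoszM.
by [].
Qed.

Lemma bezout_card_poly d1 d2 a (G : {poly {poly rat}}) b1 b2 K :
  (0 < d2)%N -> irrXY d1 d2 (dehomQ d1 d2 a) ->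
  (size G <= d2.+1)%N -> (sizeY G <= d1.+1)%N -> G != 0 ->
  uniq K -> (forall P, P \in K -> valid b1 b2 P) ->
  (forall P, P \in K -> bevp d1 d2 a P = 0) ->
  (forall P, P \in K -> P.1.2 != 0 -> P.2.2 != 0 -> root (fiber G (xi P.1)) (xi P.2)) ->
  (exists H, G = H * dehomQ d1 d2 a) \/
  (size K <= 2 * d1 * d2 * d2 + d1.+1 + d2)%N.
Proof.
move=> d20 irF sG yG G0 uK vK zK rK.
have [|[R [R0 sR rR]]] := bezout_elim d20 irF sG yG G0; first by left.
right; apply: (bezout_card d20 irF R0 _ uK vK zK).
  by apply: leq_trans sR _; rewrite ltnS -mulnA; lia.
move=> P PK h1 h2; apply: (rR _ (xi P.2)); last exact: rK.
by apply: root_fiber => //; apply: zK.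
Qed.

(** The factor 4 is 2 * 2: half of the points may be lost to the choice of p, and [good_card] counts
    in two charts. The first summand bounds the points discarded by Bezout, with [g] or with its
    derivative. *)
Lemma core_bound d1 d2 a b1 b2 D Q (K : seq pt)
  (M := (d1.+1 * d2.+1)%N) (A := (b1 ^ d1 * b2 ^ d2)%N)
  (kap := (d1 * d2.-1 + d2 * D).+1) :
  (0 < d1)%N -> (0 < d2)%N -> irrXY d1 d2 (dehomQ d1 d2 a) ->
  (0 < b1)%N -> (0 < b2)%N -> (0 < D)%N -> (b2 <= 2 ^ D)%N ->
  (16 ^ d2 * b1 ^ 2 <= Q ^ d2)%N ->
  ((M * d2 * ((M * A) ^ M * A)) ^ 2 < primorial Q (6 * Q))%N ->
  uniq K -> (forall P, P \in K -> valid b1 b2 P) ->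
  (forall P, P \in K -> bevp d1 d2 a P = 0) ->
  (size K <= (2 * d1 * d2 * d2 + d1.+1 + d2) + 4 * (6 * Q * d2 * kap))%N.
Proof.
move=> d10 d20 irF b10 b20 D0 hb2 hQ hX uK vK zK.
have F0 := irrXY_neq0 irF; have [sF yF _] := irF.
have A0 : (0 < A)%N by rewrite muln_gt0 !expn_gt0 b10 b20.
have sM : #|{: monoms d1 d2}| = M by rewrite card_prod !card_ord.
have A1 : 1 <= A%:Z by rewrite lez_nat.
have [||g [[i0 [j0 [hi0 hj0 g0]]] zG gB]] := @vanishing_form d1 d2 K A%:Z A1.
- move=> P i j /vK /valid_le [h1 h2 h3 h4] hi hj.
  by rewrite /A PoszM !PoszX; apply: monval_le.
- move=> Pf PfK; have [i0 [j0 [hi0 hj0 a0]]] := dehomQ_coef_neq0 F0.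
  (* The coefficients of the given form are a nonzero kernel vector of every such square matrix. *)
  rewrite -det_tr; apply/eqP/det0P.
  exists (\row_(j < #|{: monoms d1 d2}|) a (enum_val j).1 (enum_val j).2).
    apply/negP => /eqP /rowP /(_ (enum_rank (inord i0, inord j0) : 'I_#|{: monoms d1 d2}|)).
    by rewrite !mxE enum_rankK /= !inordK ?ltnS // => /eqP; rewrite (negbTE a0).
  apply/rowP => k; rewrite !mxE -[RHS](zK _ (PfK k)) bevp_sum; apply: eq_bigr => j _.
  by rewrite !mxE mulrC.
rewrite sM in gB.
pose G := dehomQ d1 d2 g.
have G0 : G != 0 by apply: dehomQ_neq0 hi0 hj0 g0.
have [|[H EG]|h] := bezout_card_poly d20 irF (size_dehom _ _ _) (sizeY_dehom _ _ _) G0 uK vK zK.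
- by move=> P PK h1 h2; apply: root_fiber => //; apply: zG.
- have {}EG : G = H * dehomQ d1 d2 a := EG.
  have H0 : H != 0 by apply: contraNneq G0 => H0; rewrite EG H0 mul0r.
  (* [G] and [F] have the same degree bounds, and [F] attains them. *)
  have cH : const2 H.
    have s1 := size_mul H0 F0; have s2 := sizeYM H0 F0.
    have := size_dehom d1 d2 (fun i j => (g i j)%:~R : rat).
    have := sizeY_dehom d1 d2 (fun i j => (g i j)%:~R : rat).
    rewrite -/G EG s1 s2 sF yF /const2.
    by clear; move: (size H) (sizeY H) => u w; lia.
  have [c Ec] := const2P cH.
  have c0 : c != 0 by apply: contraNneq H0 => c0; rewrite Ec c0.
  have irG : irrXY d1 d2 G by rewrite EG Ec; apply: irrXY_scale.
  pose v P := absz (bevdp d1 d2 g P).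
  rewrite -(count_predC (fun P => bevdp d1 d2 g P == 0)) -!size_filter.
  set K1 := filter _ K; set K2 := filter _ K.
  have uK1 : uniq K1 by apply: filter_uniq.
  have uK2 : uniq K2 by apply: filter_uniq.
  have K1P P : P \in K1 -> P \in K /\ bevdp d1 d2 g P = 0.
    by rewrite mem_filter => /andP [/eqP ? ?]; split.
  have K2P P : P \in K2 -> P \in K /\ bevdp d1 d2 g P != 0.
    by rewrite mem_filter => /andP [? ?]; split.
  apply: leq_add.
    have [sG yG _] := irG.
    have dG0 : G^`() != 0.
      apply/negP => /eqP /(congr1 (fun q : {poly {poly rat}} => q`_d2.-1)).
      rewrite coef_deriv coef0 prednK // => /eqP; rewrite -mulr_natr mulf_eq0.
      have -> : G`_d2 = lead_coef G by rewrite lead_coefE sG.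
      rewrite lead_coef_eq0 (negbTE G0) /= -polyC_natr polyC_eq0 pnatr_eq0.
      by case: (d2) d20.
    have dGsub i : (size (G^`()`_i)%R <= d1.+1)%N.
      rewrite coef_deriv -scaler_nat (leq_trans (size_scale_leq _ _)) //.
      by apply: leq_trans (max_size_coefXY _ _) _; rewrite yG.
    have sdG : (size G^`() <= d2.+1)%N by rewrite (leq_trans (size_poly _ _)) // sG leqnSn.
    have ydG : (sizeY G^`() <= d1.+1)%N by apply/bigmax_leqP.
    have [|||[H' E']|h'] := @bezout_card_poly d1 d2 g G^`() b1 b2 K1 d20 irG sdG ydG dG0 uK1.
    + by move=> P /K1P [/vK].
    + by move=> P /K1P [/zG].
    + by move=> P /K1P [PK z] h1 h2; apply: root_fiber_deriv.
    (* The derivative has smaller degree in Y than [G], so it is not a multiple of it. *)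
    + have : (size G^`() < size G)%N by apply: lt_size_deriv.
      have H'0 : H' != 0 by apply: contraNneq dG0 => H'0; rewrite E' H'0 mul0r.
      rewrite E' -/G size_mul //.
      have : (0 < size H')%N by rewrite size_poly_gt0.
      by clear; move: (size H') (size G) => u w; lia.
    + exact: h'.
  have M0 : (0 < M)%N by [].
  have X0 : (0 < M * d2 * ((M * A) ^ M * A))%N.
    by clear -M0 A0 d20; move: M A M0 A0 => m n M0 A0; rewrite !muln_gt0 expn_gt0 muln_gt0 M0 A0 d20.
  have vX x : x \in K2 -> (0 < v x <= M * d2 * ((M * A) ^ M * A))%N.
    case/K2P => xK nz; rewrite absz_gt0 nz /= -lez_nat abszE.
    have := bevdp_le d1 d2 b20 (vK _ xK) gB.
    by rewrite -/M -/A [M%:R]natz -PoszM -PoszX -!PoszM.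
  have [p [pp /andP [Qp p6] hp]] := good_prime X0 vX hX.
  apply: leq_trans hp _; rewrite -size_filter.
  have sD : #|{: monoms D d2.-1}| = (D.+1 * d2)%N by rewrite card_prod !card_ord prednK.
  have hdet := det_beats_size D0 d20 hb2 b10 hQ Qp; rewrite -sD in hdet.
  set K3 := filter _ K2.
  have : (size K3 <= 2 * (p * d2 * kap))%N.
    apply: (good_card d20 irG b10 b20 pp D0 hdet).
    + exact: filter_uniq.
    + by move=> P; rewrite mem_filter => /andP [_ /K2P [/vK]].
    + by move=> P; rewrite mem_filter => /andP [_ /K2P [/zG]].
    + by move=> P; rewrite mem_filter => /andP [h _]; rewrite dvdzE.
  have : (p * d2 * kap <= 6 * Q * d2 * kap)%N by rewrite !leq_mul2r p6 !orbT.
  by clear; move: (size K3) (_ * kap)%N (_ * kap)%N => u w z; lia.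
- by apply: leq_trans h (leq_addr _ _).
Qed.

(** * Choice of the parameters *)

Lemma zrange_uniq n : uniq (zrange n).
Proof. by rewrite map_inj_uniq ?iota_uniq // => i j; lia. Qed.

Lemma points_bound d1 d2 (f : {mpoly int[4]}) b1 b2 D Q (K : seq pt)
  (M := (d1.+1 * d2.+1)%N) (A := (b1 ^ d1 * b2 ^ d2)%N) :
  (0 < d1)%N -> (0 < d2)%N -> bihomogeneous d1 d2 f -> irreducible_over_Q f ->
  (0 < b1)%N -> (0 < b2)%N -> (0 < D)%N -> (b2 <= 2 ^ D)%N ->
  (16 ^ d2 * b1 ^ 2 <= Q ^ d2)%N ->
  ((M * d2 * ((M * A) ^ M * A)) ^ 2 < primorial Q (6 * Q))%N ->
  uniq K -> (forall P, P \in K -> valid b1 b2 P) ->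
  (forall P, P \in K -> eval4 f P.1.1 P.1.2 P.2.1 P.2.2 = 0) ->
  (size K <= (2 * d1 * d2 * d2 + d1.+1 + d2) +
     4 * (6 * Q * d2 * (d1 * d2.-1 + d2 * D).+1))%N.
Proof.
move=> d10 d20 bf irf b10 b20 D0 hb2 hQ hX uK vK zK.
apply: (@core_bound d1 d2 (coef2 d1 d2 f) b1 b2) => //.
  exact: irreducible_irrXY.
by move=> P /zK; rewrite (eval4E _ _ _ _ bf).
Qed.

Lemma smooth_value_bound M d2 A : (d2 <= M)%N -> (0 < A)%N -> (0 < M)%N ->
  ((M * d2 * ((M * A) ^ M * A)) ^ 2 <= (M * A) ^ (2 * M.+2))%N.
Proof.
move=> dM A0 M0; rewrite [(2 * _)%N]mulnC expnM leq_exp2r //.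
rewrite -[M.+2]addn2 expnD mulnCA leq_mul // expnS expn1 -!mulnA leq_mul //.
by apply: leq_trans (leq_pmull _ A0); rewrite leq_mul.
Qed.

From Stdlib Require Import Reals Lra.
Close Scope ring_scope.
Local Open Scope R_scope.

Lemma RlebP a b : Rleb a b -> a <= b.
Proof. by rewrite /Rleb; case: Rle_dec. Qed.

Lemma INR_addn m n : INR (addn m n) = INR m + INR n.
Proof. by rewrite -plusE plus_INR. Qed.

Lemma INR_muln m n : INR (muln m n) = INR m * INR n.
Proof. by rewrite -multE mult_INR. Qed.

Lemma INR_expn m n : INR (expn m n) = (INR m ^ n).
Proof. by elim: n => // n IH; rewrite expnS INR_muln IH. Qed.

Lemma INR_leq m n : leq m n -> INR m <= INR n.
Proof. by move/ssrnat.leP; apply: le_INR. Qed.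

Lemma leq_INR m n : INR m <= INR n -> leq m n.
Proof. by move/INR_le/ssrnat.leP. Qed.

Lemma nat_floor x : 0 <= x -> exists n, INR n <= x < INR n + 1.
Proof.
move=> x0; have [h1 h2] := archimed x.
have z : (0 <= up x - 1)%Z.
  suff : (0 < up x)%Z by lia.
  by apply: lt_IZR; lra.
exists (Z.to_nat (up x - 1)); rewrite INR_IZR_INZ Znat.Z2Nat.id // minus_IZR; lra.
Qed.

Lemma ln_mono a b : 0 < a -> a <= b -> ln a <= ln b.
Proof.
by move=> a0 [ab|->]; [apply/Rlt_le/ln_increasing | apply: Rle_refl].
Qed.

Lemma ln_le_id x : 0 < x -> ln x <= x - 1.
Proof. by move=> x0; have := exp_ineq1_le (ln x); rewrite exp_ln //; lra. Qed.

Lemma N_P1P1_size f B1 B2 b1 b2 : B1 < INR b1 + 1 -> B2 < INR b2 + 1 ->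
  exists K : seq pt, [/\ N_P1P1 f B1 B2 = size K, uniq K,
    forall P, P \in K -> valid b1 b2 P &
    forall P, P \in K -> eval4 f P.1.1 P.1.2 P.2.1 P.2.2 = GRing.zero].
Proof.
move=> hB1 hB2; rewrite /N_P1P1; set S := flatten _.
set q := (X in count X S).
exists (filter q S); split.
- by rewrite size_filter.
- apply: filter_uniq; apply: allpairs_uniq; last by move=> [x y] [x' y'].
    by apply: allpairs_uniq; rewrite ?zrange_uniq // => -[x y] [x' y'].
  by apply: allpairs_uniq; rewrite ?zrange_uniq // => -[x y] [x' y'].
- move=> [[x1 x2] [y1 y2]]; rewrite mem_filter => /andP [/and5P [h1 h2 /RlebP h3 /RlebP h4 _] _].
  apply/and4P; split => //=; rewrite -ltnS; apply/ssrnat.ltP; apply: INR_lt; rewrite S_INR; lra.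
- by move=> [[x1 x2] [y1 y2]]; rewrite mem_filter => /andP [/and5P [_ _ _ _ /eqP]].
Qed.

Section Final.
Variables (d1 d2 b1 b2 : nat) (B1 B2 : R).
Hypotheses (d10 : leq 1 d1) (d20 : leq 1 d2).
Hypotheses (hb1 : INR b1 <= B1) (hB1 : 1 <= B1).
Hypotheses (hb2 : INR b2 <= B2) (hB2 : 2 <= B2).
Hypotheses (b10 : leq 1 b1) (b20 : leq 1 b2).

Let x := INR d1.
Let y := INR d2.
Let T := Rpower B1 (2 / y).
Let l := ln B2.

Let x1 : 1 <= x.
Proof. exact: (INR_leq d10). Qed.

Let y1 : 1 <= y.
Proof. exact: (INR_leq d20). Qed.

Let l2 : / 2 <= l.
Proof.
apply: Rle_trans (Rlt_le _ _ ln_lt_2) _; apply: ln_mono; lra.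
Qed.

Let lB1 : 0 <= ln B1.
Proof. by rewrite -ln_1; apply: ln_mono; lra. Qed.

Let T1 : 1 <= T.
Proof.
rewrite /T /Rpower; have := exp_ineq1_le (2 / y * ln B1).
suff : 0 <= 2 / y * ln B1 by lra.
by apply: Rmult_le_pos => //; apply: Rlt_le; apply: Rdiv_lt_0_compat; lra.
Qed.

(** From 1 + u <= exp u with u = (2 / y) ln B1. This absorbs the logarithm of [B1] into [T], so the
    final bound contains none. *)
Let lT : ln B1 <= y * T / 2.
Proof.
have := exp_ineq1_le (2 / y * ln B1); rewrite -/(Rpower B1 (2 / y)) -/T => h.
have -> : ln B1 = y / 2 * (2 / y * ln B1) by field; lra.
have : y / 2 * (2 / y * ln B1) <= y / 2 * T by apply: Rmult_le_compat_l; lra.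
by lra.
Qed.

Let TB : T ^ d2 = B1 ^ 2.
Proof.
rewrite -Rpower_pow; last by lra.
rewrite /T Rpower_mult -/y; have -> : 2 / y * y = INR 2 by rewrite /=; field; lra.
by rewrite Rpower_pow //; lra.
Qed.

Let lnb b B : leq 1 b -> INR b <= B -> ln (INR b) <= ln B.
Proof.
by move=> b0 bB; apply: ln_mono => //; have := INR_leq b0; rewrite /=; lra.
Qed.

Let M := muln d1.+1 d2.+1.
Let A := muln (expn b1 d1) (expn b2 d2).

(** The target size of Q. As ln 2 > 1/2, the constant must exceed twice the 120 of [MA_bound]; 256
    does, and it also gives [16 * T <= Y]. *)
Let Y := 256 * (x ^ 2 * y ^ 2) * T * l.

Let xy1 : 1 <= x * y.
Proof. by nra. Qed.

Let Tl : / 2 <= T * l.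
Proof. by nra. Qed.

(** 120 = 12 * 10. The exponent is at most 12 x y. In the logarithm of M A, the part ln M <= 4 x y
    costs 8 x y T l because T l >= 1/2, and the powers of b1 and b2 cost x y T l each. *)
Let MA_bound : ln (INR (expn (muln M A) (muln 2 M.+2))) <= 120 * (x ^ 2 * y ^ 2) * (T * l).
Proof.
have M1 : 1 <= INR M by apply: (@INR_leq 1).
have A1 : 1 <= INR A by apply: (@INR_leq 1); rewrite muln_gt0 !expn_gt0 b10 b20.
have EM : INR M = (x + 1) * (y + 1) by rewrite INR_muln !S_INR.
have M4 : INR M <= 4 * (x * y) by rewrite EM; nra.
have lM : ln (INR M) <= 4 * (x * y).
  by have := @ln_le_id (INR M); lra.
have pb1 : 0 < INR b1 by have := INR_leq b10; rewrite /=; lra.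
have pb2 : 0 < INR b2 by have := INR_leq b20; rewrite /=; lra.
have lA : ln (INR A) <= x * ln B1 + y * l.
  rewrite INR_muln !INR_expn ln_mult; try exact: pow_lt.
  rewrite !ln_pow //; apply: Rplus_le_compat; apply: Rmult_le_compat_l; try (rewrite -/x -/y; lra).
    exact: lnb.
  exact: lnb.
rewrite INR_expn ln_pow; last by rewrite (INR_muln M A); nra.
rewrite (INR_muln M A) ln_mult; try lra.
have E2 : INR 2 = 2 by rewrite /=; lra.
rewrite (INR_muln 2) E2 (S_INR M.+1) (S_INR M).
have h1 : ln (INR M) + ln (INR A) <= 10 * (x * y) * (T * l).
  have k1 : x * ln B1 <= x * y * (T * l).
    apply: (Rle_trans _ (x * (y * T / 2))); first by apply: Rmult_le_compat_l; lra.
    have : (x * y) * (T * / 2) <= (x * y) * (T * l); last by lra.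
    by apply: Rmult_le_compat_l; [lra | apply: Rmult_le_compat_l; lra].
  have k2 : y * l <= x * y * (T * l).
    have a : 1 <= x * T by nra.
    have b : 0 <= y * l by nra.
    have : 1 * (y * l) <= (x * T) * (y * l) by apply: Rmult_le_compat_r.
    by lra.
  have k3 : (x * y) * / 2 <= (x * y) * (T * l) by apply: Rmult_le_compat_l; lra.
  by lra.
have h0 : 0 <= ln (INR M) + ln (INR A).
  have a : 0 <= ln (INR M) by rewrite -ln_1; apply: ln_mono; lra.
  have b : 0 <= ln (INR A) by rewrite -ln_1; apply: ln_mono; lra.
  by lra.
have h2 : 2 * (INR M + 1 + 1) <= 12 * (x * y) by lra.
apply: Rle_trans (_ : 12 * (x * y) * (10 * (x * y) * (T * l)) <= _).
  by apply: Rmult_le_compat; lra.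
by lra.
Qed.
Let a : 1 <= x ^ 2 * y ^ 2.
Proof.
have -> : x ^ 2 * y ^ 2 = (x * y) * (x * y) by ring.
by nra.
Qed.

Let Y128 : 128 <= Y.
Proof.
have : 1 * / 2 <= (x ^ 2 * y ^ 2) * (T * l) by apply: Rmult_le_compat; lra.
by rewrite /Y; lra.
Qed.

Let YT : 16 * T <= Y.
Proof.
have h : 1 * (/ 2) <= (x ^ 2 * y ^ 2) * l by apply: Rmult_le_compat; lra.
have : T * (/ 2) <= T * ((x ^ 2 * y ^ 2) * l) by apply: Rmult_le_compat_l; lra.
by rewrite /Y; lra.
Qed.

Lemma parameters : exists D Q, [/\ leq 1 D, leq b2 (expn 2 D),
    leq (muln (expn 16 d2) (expn b1 2)) (expn Q d2),
    leq (expn (muln M A) (muln 2 M.+2)).+1 (primorial Q (muln 6 Q)) &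
    INR D <= 4 * l /\ INR Q <= 4 * Y].
Proof.
have [n [n1 n2]] := @nat_floor Y ltac:(lra).
have n64 : leq (expn 4 3) n.
  by apply: leq_INR; rewrite INR_expn /=; lra.
have n0 : leq 1 n by apply: leq_trans n64.
(* [Q] is the first power of 4 above [n], which loses at most a factor 4; [n64] ensures the [4 <= k]
   of [primorial_ge]. *)
pose k := (trunc_log 4 n).+1; pose Q := expn 4 k.
have nQ : leq n.+1 Q by exact: trunc_log_ltn.
have Qn : leq Q (muln 4 n) by rewrite /Q expnS leq_mul2l trunc_logP.
have k4 : leq 4 k by rewrite ltnS trunc_log_max.
have QY : Y <= INR Q by have := INR_leq nQ; rewrite S_INR; lra.
have QY' : INR Q <= 4 * Y by have := INR_leq Qn; rewrite INR_muln /=; lra.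
(* [trunc_log 2 b2] is at most 2 l since ln 2 > 1/2, and the successor costs another 2 l since l >=
   1/2. *)
exists (trunc_log 2 b2).+1, Q; split => //.
- by rewrite ltnW // trunc_log_ltn.
- apply: leq_INR; rewrite INR_muln (INR_expn 16) (INR_expn b1) (INR_expn Q).
  apply: (Rle_trans _ ((16 * T) ^ d2)); last first.
    by apply: pow_incr; split; lra.
  rewrite Rpow_mult_distr TB; have -> : INR 16 = 16 by rewrite /=; lra.
  apply: Rmult_le_compat_l; first by apply: pow_le; lra.
  by apply: pow_incr; split; [apply: pos_INR |].
- apply: leq_trans (primorial_ge k4).
  apply/ssrnat.ltP; apply: INR_lt.
  have p0 : 0 < INR (expn (muln M A) (muln 2 M.+2)).
    by apply: lt_0_INR; apply/ssrnat.ltP; rewrite expn_gt0 muln_gt0 /A muln_gt0 !expn_gt0 b10 b20.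
  have p1 : 0 < INR (expn 2 (expn 4 k)).
    by apply: lt_0_INR; apply/ssrnat.ltP; rewrite expn_gt0.
  apply: ln_lt_inv => //; apply: Rle_lt_trans MA_bound _.
  rewrite INR_expn ln_pow; last by rewrite /=; lra.
  rewrite -/Q; have -> : INR 2 = 2 by rewrite /=; lra.
  apply: (Rlt_le_trans _ (Y * / 2)).
    by move: Y128; rewrite /Y; lra.
  by apply: Rmult_le_compat; have := ln_lt_2; lra.
- split => //; rewrite S_INR.
  have : leq (expn 2 (trunc_log 2 b2)) b2 by rewrite trunc_logP.
  move/INR_leq; rewrite INR_expn => h.
  have := ln_mono (pow_lt (INR 2) (trunc_log 2 b2) ltac:(rewrite /=; lra)) (Rle_trans _ _ _ h hb2).
  rewrite ln_pow; last by rewrite /=; lra.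
  have -> : INR 2 = 2 by rewrite /=; lra.
  rewrite -/l => h'.
  have : INR (trunc_log 2 b2) * / 2 <= INR (trunc_log 2 b2) * ln 2.
    by apply: Rmult_le_compat_l; [apply: pos_INR | have := ln_lt_2; lra].
  by lra.
Qed.

(** The main term gives 147456 = 24 * (4 * 256) * 6 times x ^ 3 y ^ 4 T l ^ 2. The Bezout terms are
    at most 5 x y ^ 2, hence at most 20 times the same quantity because T l ^ 2 >= 1/4. Finally x ^
    4 >= 1 raises the power of x to 7. *)
Lemma numeric_bound D Q : INR D <= 4 * l -> INR Q <= 4 * Y ->
  INR (addn (addn (addn (muln (muln (muln 2 d1) d2) d2) d1.+1) d2)
     (muln 4 (muln (muln (muln 6 Q) d2) (addn (muln d1 d2.-1) (muln d2 D)).+1)))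
  <= 150000 * x ^ 7 * y ^ 4 * T * l ^ 2.
Proof.
move=> hD hQ.
have Ed : INR d2.-1 = y - 1 by rewrite /y -{2}(prednK d20) S_INR; lra.
rewrite (INR_addn _ (muln 4 _)) (INR_muln 4) (INR_muln (muln (muln 6 Q) d2)).
rewrite (INR_muln (muln 6 Q)) (INR_muln 6) (S_INR (addn _ _)) (INR_addn (muln d1 _)).
rewrite (INR_muln d1) (INR_muln d2) Ed (INR_addn _ d2) (INR_addn _ d1.+1) (S_INR d1).
rewrite (INR_muln (muln (muln 2 d1) d2)) (INR_muln (muln 2 d1)) (INR_muln 2) -/x -/y.
have -> : INR 2 = 2 by rewrite /=; lra.
have -> : INR 4 = 4 by rewrite /=; lra.
have -> : INR 6 = 6 by rewrite /=; lra.
set d := INR D in hD *; set q := INR Q in hQ *.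
have d0 : 0 <= d by apply: pos_INR.
have q0 : 0 <= q by apply: pos_INR.
have yl : 0 <= y * l by nra.
have kap : x * (y - 1) + y * d + 1 <= 6 * (x * y * l).
  have a1 : y * d <= y * (4 * l) by apply: Rmult_le_compat_l; lra.
  have a2 : 1 * (y * l) <= x * (y * l) by apply: Rmult_le_compat_r; lra.
  have a3 : (x * y) * / 2 <= (x * y) * l by apply: Rmult_le_compat_l; lra.
  by lra.
have kap0 : 0 <= x * (y - 1) + y * d + 1 by nra.
have E1 : 4 * (6 * q * y * (x * (y - 1) + y * d + 1)) <=
    147456 * (x ^ 3 * y ^ 4 * (T * l ^ 2)).
  have : q * y * (x * (y - 1) + y * d + 1) <= (4 * Y * y) * (6 * (x * y * l)).
    apply: Rmult_le_compat => //; first by nra.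
    by apply: Rmult_le_compat_r; lra.
  by rewrite /Y; lra.
have X1 : 1 <= x ^ 2 by rewrite -(pow1 2); apply: pow_incr; lra.
have X2 : 1 <= x ^ 4 by rewrite -(pow1 4); apply: pow_incr; lra.
have Y2 : 1 <= y ^ 2 by rewrite -(pow1 2); apply: pow_incr; lra.
have L2 : / 4 <= l ^ 2.
  have -> : / 4 = (/ 2) ^ 2 by field.
  by apply: pow_incr; lra.
have P : / 4 <= T * l ^ 2.
  by have : 1 * / 4 <= T * l ^ 2; [apply: Rmult_le_compat; lra | lra].
have xyy : 1 <= x * y ^ 2 by have : 1 * 1 <= x * y ^ 2; [apply: Rmult_le_compat; lra | lra].
have E2 : 2 * x * y * y + (x + 1) + y <= 5 * (x * y ^ 2).
  by nra.
have E3 : x * y ^ 2 <= x ^ 3 * y ^ 4.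
  have -> : x ^ 3 * y ^ 4 = (x * y ^ 2) * (x ^ 2 * y ^ 2) by ring.
  have : (x * y ^ 2) * (1 * 1) <= (x * y ^ 2) * (x ^ 2 * y ^ 2); last by lra.
  apply: Rmult_le_compat_l; first by lra.
  by apply: Rmult_le_compat; lra.
have W0 : 0 <= x ^ 3 * y ^ 4 by lra.
have E4 : (x ^ 3 * y ^ 4) * / 4 <= (x ^ 3 * y ^ 4) * (T * l ^ 2).
  by apply: Rmult_le_compat_l.
have E5 : (x ^ 3 * y ^ 4) * (T * l ^ 2) * 1 <= (x ^ 3 * y ^ 4) * (T * l ^ 2) * x ^ 4.
  by apply: Rmult_le_compat_l; lra.
have -> : 150000 * x ^ 7 * y ^ 4 * T * l ^ 2 =
  150000 * ((x ^ 3 * y ^ 4) * (T * l ^ 2) * x ^ 4) by ring.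
by lra.
Qed.

End Final.

Close Scope R_scope.

Theorem theorem3p3 :
  exists C : R, forall (d1 d2 : nat) (f : {mpoly int[4]}) (B1 B2 : R),
    (1 <= d1)%N -> (1 <= d2)%N ->
    bihomogeneous d1 d2 f -> irreducible_over_Q f ->
    (1 <= B1)%R -> (2 <= B2)%R ->
    (INR (N_P1P1 f B1 B2)
       <= C * INR d1 ^ 7 * INR d2 ^ 4 * Rpower B1 (2 / INR d2) * (ln B2) ^ 2)%R.
Proof.
exists 150000%R => d1 d2 f B1 B2 d10 d20 bf irf hB1 hB2.
have [b1 [lb1 ub1]] := @nat_floor B1 ltac:(lra).
have [b2 [lb2 ub2]] := @nat_floor B2 ltac:(lra).
have b10 : leq 1 b1 by apply/ssrnat.ltP; apply: INR_lt; rewrite /=; lra.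
have b20 : leq 1 b2 by apply/ssrnat.ltP; apply: INR_lt; rewrite /=; lra.
have [D [Q [D0 h1 h2 h3 [hD hQ]]]] := parameters d10 d20 lb1 hB1 lb2 hB2 b10 b20.
have [K [-> uK vK zK]] := N_P1P1_size f ub1 ub2.
have A0 : leq 1 (muln (expn b1 d1) (expn b2 d2)).
  by rewrite muln_gt0 !expn_gt0 b10 b20.
have dM : leq d2 (muln d1.+1 d2.+1).
  exact: leq_trans (leqnSn d2) (leq_pmull _ (ltn0Sn d1)).
have h4 := leq_ltn_trans (smooth_value_bound dM A0 (ltn0Sn _)) h3.
have := points_bound d10 d20 bf irf b10 b20 D0 h1 h2 h4 uK vK zK.
move/INR_leq => h; apply: Rle_trans h _.
exact: numeric_bound.
Qed.
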